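(* Let $q$ be a prime power, $n$ odd with $n-3\ge 2$, let $\Sigma\cong\mathrm{PG}(n-1,q)$ be a canonical subgeometry of $\mathrm{PG}(n-1,q^n)$ and $\Gamma$ a subspace of $\mathrm{PG}(n-1,q^n)$ of dimension $n-3$ with $\Gamma\cap\Sigma=\emptyset$. Assume that there is a generator $\sigma$ of the subgroup of $\mathrm{P}\Gamma\mathrm{L}(n,q^n)$ fixing $\Sigma$ pointwise such that $\mathrm{intn}_\sigma(\Gamma)=2$. Then there exists a point $R\in\mathrm{PG}(n-1,q^n)$ such that $R^{\sigma^2},R^{\sigma^3},\ldots,R^{\sigma^{n-2}}\in\Gamma$. Furthermore, assume that the line $\langle R^{\sigma},R^{\sigma^{n-1}}\rangle$ and $\Gamma$ meet in a point $Q$ with $R^{\sigma}\neq Q\neq R^{\sigma^{n-1}}$, and let $Q'$ be the point defined as follows: there are representative vectors $v_0$, $v_1$ of $R^{\sigma}$ and $R^{\sigma^{n-1}}$ respectively with $\langle v_0+v_1\rangle_{\mathbb{F}_{q^n}}=Q$, and $Q'=\langle v_0-v_1\rangle_{\mathbb{F}_{q^n}}$ (so that $\{R^\sigma,R^{\sigma^{n-1}}\}$ separates $\{Q,Q'\}$ harmonically). Let $\Lambda$ be a line disjoint from $\Gamma$. Then the linear set $L=p_{\Gamma,\Lambda}(\Sigma)$ is a maximum scattered linear set of LP-type if and only if \[\Sigma\cap\langle R,R^{\sigma^2},R^{\sigma^3},\ldots,R^{\sigma^{n-2}},Q'\rangle=\emptyset .\]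
   Context: A canonical subgeometry of $\mathrm{PG}(n-1,q^n)=\mathrm{PG}(V,\mathbb{F}_{q^n})$ is a set $\{\langle u\rangle_{\mathbb{F}_{q^n}}: u\in S\setminus\{0\}\}$ where $S$ is an $n$-dimensional $\mathbb{F}_q$-subspace of $V$ spanning $V$ over $\mathbb{F}_{q^n}$. The subgroup of $\mathrm{P}\Gamma\mathrm{L}(n,q^n)$ fixing $\Sigma$ pointwise is cyclic of order $n$. The projection is $p_{\Gamma,\Lambda}(\Sigma)=\{\langle\Gamma,X\rangle\cap\Lambda : X\in\Sigma\}$. For a subspace $\Gamma$ of (projective) dimension $k$, $\mathrm{intn}_\sigma(\Gamma)$ is the least positive integer $r$ with $\dim(\Gamma\cap\Gamma^{\sigma}\cap\cdots\cap\Gamma^{\sigma^r})>k-2r$ (empty subspace has dimension $-1$). For a $2$-dimensional $\mathbb{F}_{q^n}$-space $W$, an $\mathbb{F}_q$-linear set of $\mathrm{PG}(W,\mathbb{F}_{q^n})$ of rank $\rho$ is $L_U=\{\langle u\rangle_{\mathbb{F}_{q^n}}: u\in U\setminus\{0\}\}$ for a $\rho$-dimensional $\mathbb{F}_q$-subspace $U$ of $W$; the weight of $\langle u\rangle$ is $\dim_{\mathbb{F}_q}(U\cap\langle u\rangle_{\mathbb{F}_{q^n}})$; $L_U$ is maximum scattered if it has rank $n$ and all points have weight one. Linear sets are equivalent if related by an element of $\mathrm{P}\Gamma\mathrm{L}(2,q^n)$. A linear set is of LP-type if it is equivalent to a maximum scattered linear set $L^n_{s,\delta}=\{\langle (x,\delta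 x^{q^s}+x^{q^{n-s}})\rangle_{\mathbb{F}_{q^n}}: x\in\mathbb{F}_{q^n}^*\}$ for some $\delta\in\mathbb{F}_{q^n}^*$ and $s$ with $\gcd(s,n)=1$. *)

(* Defs.v *)
From HB Require Import structures.
From mathcomp Require Import all_boot all_order all_algebra all_field.
From mathcomp Require Import boolp classical_sets functions.

Set Implicit Arguments.
Unset Strict Implicit.
Unset Printing Implicit Defensive.

Import Order.TTheory GRing.Theory Num.Theory.
Local Open Scope classical_set_scope.
Local Open Scope ring_scope.

(* Restriction of scalars: for V over L and L over F, [scalar_restr V] is V    *)
(* regarded as a vector space over F, so that {vspace scalar_restr V} is the   *)
(* type of F-subspaces of V. *)
Section ScalarRestriction.

Variables (F : fieldType) (L : fieldExtType F) (V : vectType L).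

Definition scalar_restr : Type := V.
Notation V0 := scalar_restr.

HB.instance Definition _ := GRing.Zmodule.on V0.

Definition scalar_restr_scale (a : F) (u : V0) : V0 := in_alg L a *: (u : V).
Local Infix "*F:" := scalar_restr_scale (at level 40).

Fact scalar_restr_scaleA a b u : a *F: (b *F: u) = (a * b) *F: u.
Proof. by rewrite [_ *F: _]scalerA -rmorphM. Qed.

Fact scalar_restr_scale1 u : 1 *F: u = u.
Proof. by rewrite /(1 *F: u) rmorph1 scale1r. Qed.

Fact scalar_restr_scaleDr a u v : a *F: (u + v) = a *F: u + a *F: v.
Proof. exact: scalerDr. Qed.

Fact scalar_restr_scaleDl v a b : (a + b) *F: v = a *F: v + b *F: v.
Proof. by rewrite -scalerDl -rmorphD. Qed.

HB.instance Definition _ := GRing.Zmodule_isLmodule.Build F V0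
  scalar_restr_scaleA scalar_restr_scale1
  scalar_restr_scaleDr scalar_restr_scaleDl.

Lemma scalar_restr_scaleE a (u : V) : a *: (u : V0) = a%:A *: u.
Proof. by []. Qed.

Let n := \dim {:L}.
Let bL : n.-tuple L := vbasis {:L}.
Let coordL (x : L) := coord_vbasis (memvf x).

Fact scalar_restr_vectMixin : Lmodule_hasFinDim F V0.
Proof.
pose bV := vbasis {:V}; set m := \dim {:V} in bV.
pose v2r (x : V0) := mxvec (\matrix_(i, j) coord bL j (coord bV i (x : V))).
have v2r_lin: linear v2r.
  move=> a x y; rewrite -linearP; congr mxvec; apply/matrixP=> i j.
  by rewrite !mxE linearP /= mulr_algl linearP.
pose r2v r : V0 := \sum_(i < m) (\sum_(j < n) vec_mx r i j *: bL`_j) *: bV`_i.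
have v2rK: cancel v2r r2v.
  move=> x; transitivity (\sum_(i < m) coord bV i (x : V) *: bV`_i); last first.
    by rewrite -coord_vbasis ?memvf.
  apply: eq_bigr => i _; rewrite mxvecK; congr (_ *: _ : V).
  by rewrite (coordL (coord bV i (x : V))); apply: eq_bigr => j _; rewrite mxE.
exists (m * n)%N, v2r => //; exists r2v => // r.
apply: (canLR vec_mxK); apply/matrixP=> i j; rewrite mxE.
by rewrite !coord_sum_free ?(basis_free (vbasisP _)).
Qed.

HB.instance Definition _ := scalar_restr_vectMixin.

Let FZEZ a x v : a *: ((x *: v : V) : V0) = (a *: x) *: v.
Proof. by rewrite [a *: _]scalerA -scalerAl mul1r. Qed.

Let restr_basis (W : {vspace V}) : seq V0 :=
  [seq tnth bL ij.2 *: tnth (vbasis W) ij.1 | ij : 'I_(\dim W) * 'I_n].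

(* The L-subspace W regarded as an F-subspace, see [mem_vrestr]. *)
Definition vrestr (W : {vspace V}) : {vspace V0} := <<restr_basis W>>%VS.

Lemma mem_vrestr W (v : V) : ((v : V0) \in vrestr W) = (v \in W).
Proof.
apply/idP/idP=> [/coord_span->|/coord_vbasis->]; last first.
  apply: (@memv_suml F V0) => i _.
  rewrite (coordL (coord _ i (v : V))) scaler_suml -/n.
  apply: (@memv_suml F V0) => j _.
  rewrite -/bL -FZEZ memvZ ?memv_span // -!tnth_nth.
  by apply/fintype.imageP; exists (i, j).
apply: (@memv_suml L V) => k _; rewrite fintype.nth_image; case: (enum_val k) => i j /=.
by rewrite FZEZ memvZ ?vbasis_mem ?mem_tnth.
Qed.

End ScalarRestriction.

(* The subspaces of PG(V, L) are the elements of {vspace V}; a set of points   *)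
(* is an element of set {vspace V}. *)
Section ProjectiveGeometry.

Variables (F : finFieldType) (L : fieldExtType F).

Definition points (V : vectType L) (W : {vspace V}) : set {vspace V} :=
  [set P | \dim P = 1%N /\ (P <= W)%VS].

(* Projective dimension; the empty subspace 0%VS has dimension -1. *)
Definition pdim (V : vectType L) (W : {vspace V}) : int := (\dim W)%:Z - 1.

Definition semilinear_bij (V V' : vectType L) (W : {vspace V})
    (W' : {vspace V'}) (theta : {rmorphism L -> L}) (f : V -> V') : Prop :=
  [/\ bijective theta,
      {in W &, {morph f : u v / u + v}},
      forall a, {in W, forall v, f (a *: v) = theta a *: f v} &
      set_bij [set` W] [set` W'] f].

(* The elements of PGammaL(V), through their action on all subspaces. *)
Definition PGammaL (V : vectType L) (g : {vspace V} -> {vspace V}) : Prop :=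
  exists (theta : {rmorphism L -> L}) (f : V -> V),
    semilinear_bij fullv fullv theta f /\
    forall W, [set` g W] = f @` [set` W].

Definition pointwise_stab (V : vectType L) (Sigma : set {vspace V})
    (g : {vspace V} -> {vspace V}) : Prop :=
  PGammaL g /\ forall X, Sigma X -> g X = X.

(* Powers in N suffice, all groups here being finite. *)
Definition generates_stab (V : vectType L) (Sigma : set {vspace V})
    (g : {vspace V} -> {vspace V}) : Prop :=
  pointwise_stab Sigma g /\
  forall h, pointwise_stab Sigma h -> exists k, h =1 iter k g.

(* L_U *)
Definition linear_set (V : vectType L) (U : {vspace scalar_restr V}) :
    set {vspace V} :=
  [set <[u : V]>%VS | u in [set u : V | (u : scalar_restr V) \in U /\ u != 0]].

Definition weight (V : vectType L) (U : {vspace scalar_restr V})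
    (P : {vspace V}) : nat := \dim (U :&: vrestr P)%VS.

Definition canonical_subgeometry (V : vectType L) (Sigma : set {vspace V}) :
    Prop :=
  exists S : {vspace scalar_restr V},
    [/\ \dim S = \dim {:V},
        forall W : {vspace V}, {subset S <= W} -> W = fullv &
        Sigma = linear_set S].

Definition projection (V : vectType L) (Gamma Lambda : {vspace V})
    (Sigma : set {vspace V}) : set {vspace V} :=
  [set ((Gamma + X) :&: Lambda)%VS | X in Sigma].

Definition intn_pred (V : vectType L) (g : {vspace V} -> {vspace V})
    (Gamma : {vspace V}) : pred nat :=
  fun r => (0 < r)%N &&
    (pdim Gamma - (2 * r)%:Z < pdim (\bigcap_(i < r.+1) iter i g Gamma)%VS).

Fact intn_exists (V : vectType L) (g : {vspace V} -> {vspace V})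
  (Gamma : {vspace V}) : exists r, intn_pred g Gamma r.
Proof.
exists (\dim Gamma).+1; rewrite /intn_pred /= /pdim addrAC ltrD2r.
rewrite (@lt_le_trans _ _ 0) // subr_lt0 ltz_nat mul2n -addnn.
exact: leq_trans (leq_addr _ _).
Qed.

Definition intn (V : vectType L) (g : {vspace V} -> {vspace V})
    (Gamma : {vspace V}) : nat := ex_minn (intn_exists g Gamma).

(* A, B separate Q, Q' harmonically. *)
Definition harmonic (V : vectType L) (A B Q Q' : {vspace V}) : Prop :=
  exists v0 v1 : V,
    [/\ A = <[v0]>%VS, B = <[v1]>%VS, Q = <[(v0 + v1)%R]>%VS & Q' = <[(v0 - v1)%R]>%VS].

(* X, a set of points of PG(W), is a maximum scattered linear set. *)
Definition max_scattered (V : vectType L) (W : {vspace V})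
    (X : set {vspace V}) : Prop :=
  exists U : {vspace scalar_restr V},
    [/\ (U <= vrestr W)%VS,
        \dim U = \dim {:L},
        X = linear_set U &
        forall P, X P -> weight U P = 1%N].

(* Equivalence of sets of points of PG(W) and PG(W'), under a collineation     *)
(* induced by a semilinear bijection W -> W'. *)
Definition equivalent (V V' : vectType L) (W : {vspace V}) (W' : {vspace V'})
    (X : set {vspace V}) (X' : set {vspace V'}) : Prop :=
  exists (theta : {rmorphism L -> L}) (f : V -> V'),
    semilinear_bij W W' theta f /\
    X' = [set P' : {vspace V'} | exists2 P, X P & [set` P'] = f @` [set` P]].

(* L^n_{s,delta}, with n = [L : F] and q = #|F|. *)
Definition LP_vec (s : nat) (delta x : L) : (L^o * L^o)%type :=
  (x, delta * x ^+ (#|F| ^ s) + x ^+ (#|F| ^ (\dim {:L} - s))).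

Definition LP_set (s : nat) (delta : L) : set {vspace (L^o * L^o)%type} :=
  [set <[LP_vec s delta x]>%VS | x in [set x : L | x != 0]].

(* s < n is needed for the truncated n - s in [LP_set]; the exponent s of a    *)
(* Frobenius power only matters modulo n. *)
Definition LP_type (V : vectType L) (W : {vspace V}) (X : set {vspace V}) :
    Prop :=
  exists (s : nat) (delta : L),
    [/\ (s < \dim {:L})%N, coprime s (\dim {:L}), delta != 0,
        max_scattered fullv (LP_set s delta) &
        equivalent W fullv X (LP_set s delta)].

End ProjectiveGeometry.

(* Main.v *)
(** Represent sigma by a theta-semilinear map f of V whose fixed vectors form
    the F-space S of Sigma, and write r_i = f^i(r) for a vector r of R.

    First part: intn = 2 forces D = Gamma :&: Gamma^sigma and D :&: D^sigma to
    have dimensions n-4 and n-5.  Pulling a vector back along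
    D, D :&: D^sigma, ... yields r with r_2, ..., r_(n-2) in Gamma.

    Second part: if the r_i do not span V, they span H of dimension at most
    n-2 (dimension n-1 would give intn = 1).  Then H is contained in
    <r_0, r_2, ..., r_(n-2)>, so the latter meets Sigma; and two points of
    Sigma inside H have the same image under the projection, so that L is not
    scattered.  If the r_i form a basis, S consists of the vectors
    sum_i theta^i(x) r_i, the projection becomes
    x |-> (x, delta theta(x) + theta^-1(x)), and the transversal misses Sigma
    iff theta^-1(x) = delta theta(x) has no solution x <> 0.  Two vectors y, z
    collide under the projection iff E = y theta(z) - z theta(y) satisfies
    theta^-1(E) = delta E.  As n is odd, E |-> prod_(i <= n/2) theta^(2i)(E)
    and x |-> x theta(x) translate the solutions of the two equations into each
    other.  For x theta(x) to be of the form y theta(z) - z theta(y) it suffices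
    that t theta(t) = theta(w) - w for some t <> 0 and w, which is the isotropy
    of a quadratic form over F. *)

Require Import Defs.
From HB Require Import structures.
From mathcomp Require Import all_boot all_order all_fingroup all_algebra.
From mathcomp Require Import all_solvable all_field.
From mathcomp Require Import zify ring.
From mathcomp Require Import boolp classical_sets functions.

Set Implicit Arguments.
Unset Strict Implicit.
Unset Printing Implicit Defensive.

Import Order.TTheory GRing.Theory Num.Theory.
Local Open Scope classical_set_scope.
Local Open Scope ring_scope.

(** * Powers of Frobenius *)

Section FrobeniusPowers.

Variables (F : finFieldType) (L : fieldExtType F).
Implicit Types (theta : {rmorphism L -> L}) (x : L).

Lemma mem1v_frobenius x : (x \in 1%VS) = (x ^+ #|F| == x).
Proof. by rewrite (@Fermat's_little_theorem F L 1%AS) dimv1 expn1. Qed.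

Lemma expf_card_ext x : x ^+ (#|F| ^ \dim {:L}) = x.
Proof.
by apply/eqP; rewrite -(@Fermat's_little_theorem F L {:L}%AS) memvf.
Qed.

Lemma exists_frobenius :
  exists phi : {rmorphism L -> L}, forall x, phi x = x ^+ #|F|.
Proof.
have [alpha _ Dalpha] := @galLgen F (finvect_type L) 1%AS.
exists (alpha : {rmorphism L -> L}) => x.
by rewrite -[LHS]/(alpha (x : finvect_type L)) Dalpha dimv1 expn1.
Qed.

Lemma gal_frobenius_generator : exists alpha : gal_of {:finvect_type L},
  [/\ 'Gal({:finvect_type L} / 1)%g = <[alpha]>%g, #[alpha]%g = \dim {:L} &
      forall k (x : finvect_type L), (alpha ^+ k)%g x = x ^+ (#|F| ^ k)].
Proof.
have [alpha /eqP genG Dalpha] := @galLgen F (finvect_type L) 1%AS.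
have galL := @finField_galois F (finvect_type L) _ _ (sub1v {:_}%AS).
exists alpha; split=> // [|k x].
  by have := galois_dim galL; rewrite dimv1 divn1 genG -orderE => <-.
elim: k => [|k IHk]; first by rewrite gal_id.
by rewrite expgSr galM ?memvf // IHk Dalpha dimv1 expn1 -exprM expnSr.
Qed.

Lemma frobenius_power_eq1 j :
  (forall x, x ^+ (#|F| ^ j) = x) -> (\dim {:L} %| j)%N.
Proof.
move=> idj; have [alpha [_ <- powE]] := gal_frobenius_generator.
rewrite order_dvdn; apply/eqP/eqP/gal_eqP => x _.
by rewrite powE gal_id idj.
Qed.

(** An endomorphism fixing [F] is an element of the Galois group of [L] over [F], which is cyclic
    and generated by the Frobenius; the exponent can be taken below the order [\dim {:L}]. *)
Lemma rmorphism_frobenius_power theta :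
    (forall a : F, theta a%:A = a%:A) ->
  exists2 s, (s < \dim {:L})%N & forall x, theta x = x ^+ (#|F| ^ s).
Proof.
move=> idF; have [alpha [genG <- powE]] := gal_frobenius_generator.
have fZ : scalable (theta : finvect_type L -> finvect_type L).
  move=> a x; rewrite -mulr_algl; transitivity (theta (a%:A * (x : L))) => //.
  by rewrite rmorphM idF mulr_algl.
pose fzM := GRing.isScalable.Build _ _ _ _
  (theta : finvect_type L -> finvect_type L) fZ.
pose fL : {lrmorphism finvect_type L -> finvect_type L} :=
  HB.pack (theta : finvect_type L -> finvect_type L) theta fzM.
have /kAut_to_gal[beta galbeta Dbeta] : kAut 1 {:finvect_type L} (linfun fL).
  rewrite kAutfE; apply/kHomP_tmp; split=> [x|x y _ _]; last first.
    by rewrite !lfunE /=; exact: (rmorphM theta).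
  by case/vlineP=> a ->; rewrite lfunE /=; apply: idF.
have : beta \in <[alpha]>%g by rewrite -genG.
case/cyclePmin=> s lt_s Ds; exists s => // x.
by rewrite -powE -Ds -Dbeta ?memvf // lfunE.
Qed.

Lemma frobenius_power_coprime theta s k :
    (forall x, theta x = x ^+ (#|F| ^ s)) ->
    (forall x, iter k theta x = x ^+ #|F|) -> (0 < \dim {:L})%N ->
  coprime s (\dim {:L}).
Proof.
move=> thE itE n_gt0.
have iterE j x : iter j theta x = x ^+ (#|F| ^ (s * j)).
  by elim: j => [|j IHj] /=; rewrite ?muln0 // IHj thE -exprM -expnD mulnS addnC.
(* As [theta] iterated [k] times is the Frobenius, [s * k] is 1 modulo the degree; adding the degree
   minus one stands for subtracting 1. *)
have dvd_n : (\dim {:L} %| (s * k) + (\dim {:L}).-1)%N.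
  apply: frobenius_power_eq1 => x.
  rewrite expnD exprM -iterE itE -exprM -expnS prednK //.
  exact: expf_card_ext.
rewrite /coprime -dvdn1 -(dvdn_addr 1 (_ : _ %| \dim {:L}))%N ?dvdn_gcdr //.
rewrite addn1 -{2}(prednK n_gt0).
have : (gcdn s (\dim {:L}) %| s * k + (\dim {:L}).-1)%N.
  by apply: dvdn_trans dvd_n; apply: dvdn_gcdr.
rewrite dvdn_addr ?dvdn_mulr ?dvdn_gcdl // => dvd_p.
have := dvdn_gcdr s (\dim {:L}); rewrite -{2}(prednK n_gt0) -addn1 dvdn_addr //.
by move=> dvd1; rewrite (eqP (_ : gcdn _ _ == 1)%N) ?dvd1n // -dvdn1.
Qed.

End FrobeniusPowers.

(** * Semilinear maps of finite order *)

Section SemilinearMaps.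

Variables (K : fieldType) (V : vectType K) (n : nat) (theta : {rmorphism K -> K}).
Variables (f : V -> V) (g : {vspace V} -> {vspace V}).
Hypotheses (fD : {morph f : u v / u + v})
  (fZ : forall a u, f (a *: u) = theta a *: f u)
  (n_gt0 : (0 < n)%N) (fn : forall u, iter n f u = u)
  (gE : forall W, [set` g W] = f @` [set` W]).

Lemma semilinear0 : f 0 = 0.
Proof. by rewrite -[X in f X](scale0r (0 : V)) fZ rmorph0 scale0r. Qed.

Lemma semilinear_inj : injective f.
Proof.
move=> u v fuv; rewrite -[u]fn -[v]fn -(prednK n_gt0) !iterSr.
by rewrite fuv.
Qed.

Lemma semilinear_sum (I : Type) (r : seq I) (P : pred I) (a : I -> K)
    (v : I -> V) :
  f (\sum_(i <- r | P i) a i *: v i)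
    = \sum_(i <- r | P i) theta (a i) *: f (v i).
Proof.
rewrite (big_morph f fD semilinear0).
by apply: eq_bigr => i _; rewrite fZ.
Qed.

Lemma memv_semilinear u W : (f u \in g W) = (u \in W).
Proof.
have gWE : [set` g W] (f u) <-> (f @` [set` W]) (f u) by rewrite gE.
apply/idP/idP => [/(proj1 gWE) [v Wv /semilinear_inj <-] //|Wu].
by apply: (proj2 gWE); exists u.
Qed.

Lemma semilinear_memv W v : v \in g W -> exists2 u, u \in W & v = f u.
Proof.
have gWE : [set` g W] v <-> (f @` [set` W]) v by rewrite gE.
by move/(proj1 gWE) => [u Wu <-]; exists u.
Qed.

Lemma memv_semilinear_iter i u W : (iter i f u \in iter i g W) = (u \in W).
Proof. by elim: i => //= i IHi; rewrite memv_semilinear. Qed.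

Lemma semilinear_vline u : g <[u]>%VS = <[f u]>%VS.
Proof.
apply/vspaceP=> v; apply/idP/vlineP => [/semilinear_memv[w]|[a ->]].
  by case/vlineP=> a -> ->; exists (theta a); rewrite fZ.
by rewrite memvZ // memv_semilinear memv_line.
Qed.

Lemma semilinear_iter_vline i u : iter i g <[u]>%VS = <[iter i f u]>%VS.
Proof. by elim: i => //= i ->; apply: semilinear_vline. Qed.

Lemma dim_semilinear_le W : (\dim (g W) <= \dim W)%N.
Proof.
have sub : (g W <= <<map f (vbasis W)>>)%VS.
  apply/subvP=> _ /semilinear_memv[u Wu ->].
  rewrite (coord_vbasis Wu) semilinear_sum rpred_sum // => i _.
  by rewrite memvZ // memv_span // map_f // mem_nth // size_tuple.
apply: leq_trans (dimvS sub) (leq_trans (dim_span _) _).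
by rewrite size_map size_tuple.
Qed.

(** No application of [g] raises the dimension, and [n] of them give back [W]. *)
Lemma dim_semilinear W : \dim (g W) = \dim W.
Proof.
apply/eqP; rewrite eqn_leq dim_semilinear_le /=.
have gnW : iter n g W = W.
  by apply/vspaceP=> u; rewrite -{1}(fn u) memv_semilinear_iter.
have le_i i U : (\dim (iter i g U) <= \dim U)%N.
  by elim: i => //= i; apply: leq_trans; apply: dim_semilinear_le.
by rewrite -{1}gnW -(prednK n_gt0) iterSr.
Qed.

(* Some element of the first [m] iterates depends on the previous ones; from  *)
(* there on the span of the iterates is stable.                               *)
Lemma orbit_sub (H W : {vspace V}) m u :
    (forall i, iter i f u \in H) -> (\dim H <= m)%N ->
    (forall i, (i < m)%N -> iter i f u \in W) ->
  forall i, iter i f u \in W.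
Proof.
move=> Hu le_Hm Wu; pose A k := <<mkseq (fun i => iter i f u) k>>%VS.
have memA k i : (i < k)%N -> iter i f u \in A k.
  by move=> lt_ik; apply: memv_span; apply/mapP; exists i; rewrite ?mem_iota.
have [j le_jm Aj] : exists2 j, (j <= m)%N & iter j f u \in A j.
  apply: contrapT => /forall2NP nA0; have nA k : (k <= m)%N -> ~ iter k f u \in A k.
    by move=> le_km; case: (nA0 k).
 
  suffices dimA k : (k <= m.+1)%N -> \dim (A k) = k.
    have : (A m.+1 <= H)%VS by apply/span_subvP=> _ /mapP[i _ ->].
    by move/dimvS; rewrite dimA // leqNgt ltnS le_Hm.
  elim: k => [_|k IHk lt_km]; first by rewrite /A /mkseq span_nil dimv0.
  have nAk : iter k f u \notin A k.
    by apply/negP => Ak; apply: (nA k); [rewrite -ltnS|].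
  rewrite /A mkseqS -cats1 span_cat span_seq1 dimv_disjoint_sum -/(A k).
    rewrite IHk 1?ltnW // dim_vline addnC.
    by have [fu0|//] := eqVneq (iter k f u) 0; rewrite fu0 mem0v in nAk.
  apply/eqP; rewrite -subv0; apply/subvP=> v.
  rewrite memv_cap => /andP[Av /vlineP[a Dv]]; rewrite memv0 Dv.
  have [->|nz_a] := eqVneq a 0; first by rewrite scale0r.
  case/negP: nAk; move: Av; rewrite Dv => /(memvZ a^-1).
  by rewrite scalerA mulVf // scale1r.
have stable v : v \in A j -> f v \in A j.
  move/coord_span->; rewrite semilinear_sum rpred_sum // => i _.
  rewrite memvZ // [_`_i]nth_mkseq // -iterS.
  have := ltn_ord i; rewrite leq_eqVlt => /predU1P[->//|].
  exact: memA.
have AW : (A j <= W)%VS.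
  apply/span_subvP=> _ /mapP[i lt_ij ->]; move: lt_ij; rewrite mem_iota => lt_ij.
  by apply: Wu; apply: leq_trans lt_ij _.
move=> i; apply: (subvP AW); elim: i => [|i IHi]; last exact: stable.
by case: (posnP j) Aj => [->|j_gt0 _]; last apply: (memA j 0).
Qed.

(** * Fixed vectors in invariant subspaces *)

Section FixedVectors.

Variable (e : n.-tuple V).
Hypotheses (eB : basis_of fullv e) (fe : forall i : 'I_n, f e`_i = e`_i).

Lemma coord_semilinear i u : coord e i (f u) = theta (coord e i u).
Proof.
rewrite {1}(coord_basis eB (memvf u)) semilinear_sum.
under eq_bigr => j _ do rewrite fe.
by rewrite coord_sum_free ?(basis_free eB).
Qed.

Lemma coord_basis_eq0 u : (forall i, coord e i u = 0) -> u = 0.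
Proof.
move=> u0; rewrite (coord_basis eB (memvf u)) big1 // => i _.
by rewrite u0 scale0r.
Qed.

(** Induction on the number of nonzero coordinates in the fixed basis: once a coordinate is scaled
    to 1, giving [v], either [v] is fixed or [f v - v] is a nonzero vector of [W] with fewer nonzero
    coordinates. *)
Lemma invariant_fixed_vector (W : {vspace V}) :
    (forall u, u \in W -> f u \in W) -> W != 0%VS ->
  exists2 s, s \in W /\ s != 0 & f s = s.
Proof.
move=> stW nzW; pose supp u := #|[set i | coord e i u != 0]%SET|.
have [m] := ubnP (supp (vpick W)).
have: vpick W \in W by apply: memv_pick.
have: vpick W != 0 by rewrite vpick0.
move: (vpick W) => u; elim: m u => // m IHm u nz_u Wu; rewrite ltnS => le_um.
have [i nz_ui] : exists i, coord e i u != 0.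
  apply/not_existsP=> u0; case/eqP: nz_u; apply: coord_basis_eq0 => i.
  by apply/eqP; have /negP := u0 i; rewrite negbK.
pose v := (coord e i u)^-1 *: u.
have Wv : v \in W by rewrite memvZ.
have vi : coord e i v = 1 by rewrite linearZ /= mulVf.
have [fv|nz_fv] := eqVneq (f v - v) 0.
  exists v; last by apply/eqP; rewrite -subr_eq0 fv.
  by rewrite /v scaler_eq0 invr_eq0 (negPf nz_ui).
apply: (IHm (f v - v)); rewrite ?rpredB ?stW //.
apply: leq_trans le_um; apply: proper_card; apply/properP; split.
  apply/fintype.subsetP=> j; rewrite !inE; apply: contraNneq => uj0.
  by rewrite linearB /= coord_semilinear linearZ /= uj0 mulr0 rmorph0 subrr.
exists i; rewrite inE // linearB /= coord_semilinear vi rmorph1 subrr.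
by rewrite eqxx.
Qed.

(** The second vector is sought in the kernel of a coordinate that does not vanish at the first;
    this kernel is stable because [f] acts on coordinates by [theta]. *)
Lemma invariant_two_fixed_vectors (W : {vspace V}) :
    (forall u, u \in W -> f u \in W) -> (1 < \dim W)%N ->
  exists s1 s2, [/\ s1 \in W, s2 \in W, f s1 = s1, f s2 = s2 &
    s1 != 0 /\ s2 \notin <[s1]>%VS].
Proof.
move=> stW dimW; have nzW : W != 0%VS by rewrite -dimv_eq0 -lt0n ltnW.
have [s1 [Ws1 nz1] f1] := invariant_fixed_vector stW nzW.
have [i nz_i] : exists i, coord e i s1 != 0.
  apply/not_existsP=> u0; case/eqP: nz1; apply: coord_basis_eq0 => i.
  by apply/eqP; have /negP := u0 i; rewrite negbK.
pose c : 'Hom(V, K^o) := linfun (coord e i : V -> K^o).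
have memc u : (u \in lker c) = (coord e i u == 0) by rewrite memv_ker lfunE.
pose W1 := (W :&: lker c)%VS.
have stW1 u : u \in W1 -> f u \in W1.
  rewrite !memv_cap !memc => /andP[Wu /eqP ui].
  by rewrite stW // coord_semilinear ui rmorph0 eqxx.
have nzW1 : W1 != 0%VS.
  rewrite -dimv_eq0 -lt0n -(ltn_add2r (\dim (c @: W))) add0n limg_ker_dim.
  by apply: leq_ltn_trans dimW; rewrite -[1%N](dimvf (K^o : vectType K)) dimvS ?subvf.
have [s2] := invariant_fixed_vector stW1 nzW1.
rewrite memv_cap memc => -[/andP[Ws2 /eqP s2i] nz2] f2.
exists s1, s2; split=> //; split=> //; apply/negP=> /vlineP[a Ds2].
case/eqP: nz2; move: s2i; rewrite Ds2 linearZ /= => /eqP.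
by rewrite mulf_eq0 (negPf nz_i) orbF => /eqP->; rewrite scale0r.
Qed.

(** Passing to [W :&: g W] loses exactly one dimension, since [W = g W] would produce a nonzero
    fixed vector. A chain found in the smaller space starts in [g W], and the preimage of its first
    vector prolongs it by one term. *)
Lemma semilinear_chain (W : {vspace V}) m :
    \dim W = m.+1 -> (m <= \dim (W :&: g W))%N ->
    (forall s, s \in W -> f s = s -> s = 0) ->
  exists2 r, r != 0 & forall i, (i <= m)%N -> iter i f r \in W.
Proof.
elim: m W => [|m IHm] W dimW le_cap W0.
  exists (vpick W); first by rewrite vpick0 -dimv_eq0 dimW.
  by case=> // _; apply: memv_pick.
pose W1 := (W :&: g W)%VS.
have W1W : (W1 <= W)%VS by apply: capvSl.
have dimW1 : \dim W1 = m.+1.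
  apply/eqP; rewrite eqn_leq le_cap andbT -ltnS -dimW ltn_neqAle dimvS // andbT.
  apply/negP => eq_dim.
  have eqW1 : W1 = W by apply/eqP; rewrite eqEdim W1W (eqP eq_dim) /=.
  have eqgW : W = g W.
    by apply/eqP; rewrite eqEdim dim_semilinear leqnn andbT -{1}eqW1 capvSr.
  have stW u : u \in W -> f u \in W by rewrite {2}eqgW memv_semilinear.
  have nzW : W != 0%VS by rewrite -dimv_eq0 dimW.
  have [s [Ws nz_s] fs] := invariant_fixed_vector stW nzW.
  by case/eqP: nz_s; apply: W0.
have [||u Wu fu|r1 nz_r1 Wr1] := IHm W1 => //.
- have gW1 : (g W1 <= g W)%VS.
    apply/subvP=> _ /semilinear_memv[u W1u ->]; rewrite memv_semilinear.
    exact: (subvP W1W).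
  (* [W1] and [g W1] have dimension [m.+1] and lie in [g W], of dimension [m.+2], so they meet in
     dimension at least [m]. *)
  rewrite -(leq_add2l (\dim (W1 + g W1))) dimv_sum_cap dim_semilinear dimW1.
  rewrite -[leqRHS]addSnnS leq_add2r.
  rewrite -dimW -(dim_semilinear W) dimvS // subv_add gW1 andbT.
  exact: capvSr.
- exact: W0 (subvP W1W _ Wu) fu.
have : r1 \in g W by apply: (subvP (capvSr W (g W))); apply: (Wr1 0).
case/semilinear_memv=> r Wr Dr1; exists r.
  by apply: contraNneq nz_r1 => r0; rewrite Dr1 r0 semilinear0.
case=> // i le_im; rewrite iterSr -Dr1; apply: (subvP W1W).
exact: Wr1.
Qed.

End FixedVectors.

End SemilinearMaps.

(** * Isotropic vectors over a finite field *)

Section QuadraticForms.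

Variable F : finFieldType.

(** One chosen root for each square, together with the negatives of these roots, covers [F]; both
    families contain 0, which makes the inequality strict in every characteristic. *)
Lemma double_card_squares : (#|F| < 2 * #|[set x ^+ 2 | x : F]%SET|)%N.
Proof.
set S := [set x ^+ 2 | x : F]%SET.
pose root y : F := odflt 0 [pick x | x ^+ 2 == y].
have rootK y : y \in S -> root y ^+ 2 = y.
  case/imsetP=> x _ ->; rewrite /root; case: pickP => [z /eqP //|/(_ x)].
  by rewrite eqxx.
have S0 : 0 \in S by apply/imsetP; exists 0; rewrite ?expr0n.
pose R := [set root y | y in S]%SET; pose R' := [set - root y | y in S]%SET.
have cover : R :|: R' = [set: F]%SET.
  apply/setP=> x; rewrite !inE.
  have Sx : x ^+ 2 \in S by apply: imset_f.
  have := rootK _ Sx; move/eqP; rewrite eqf_sqr => /orP[/eqP rx|/eqP rx].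
    by apply/orP; left; apply/imsetP; exists (x ^+ 2).
  by apply/orP; right; apply/imsetP; exists (x ^+ 2); rewrite // rx opprK.
have meet : (0 < #|R :&: R'|)%N.
  have root0 : root 0 = 0 by have /eqP := rootK _ S0; rewrite sqrf_eq0 => /eqP.
  apply/card_gt0P; exists 0; rewrite inE; apply/andP; split; apply/imsetP.
    by exists 0.
  by exists 0; rewrite // root0 oppr0.
have := cardsUI R R'; rewrite cover cardsT => cardF.
rewrite -(ltn_add2r #|R :&: R'|) cardF mul2n -addnn.
apply: leq_ltn_trans (_ : #|S| + #|S| < _)%N; first by rewrite leq_add ?leq_imset_card.
by rewrite -addn1 leq_add2l.
Qed.

(** Pigeonhole: the values of [a * x ^+ 2] and those of [c - b * y ^+ 2] each fill more than half of
    [F]. *)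
Lemma binary_form_onto (a b c : F) :
  a != 0 -> b != 0 -> exists x y, a * x ^+ 2 + b * y ^+ 2 = c.
Proof.
move=> nz_a nz_b; set S := [set x ^+ 2 | x : F]%SET.
pose A := [set a * s | s in S]%SET; pose B := [set c - b * s | s in S]%SET.
have cardA : #|A| = #|S| by apply: card_imset; apply: mulfI.
have cardB : #|B| = #|S|.
  by apply: card_imset => s s' /addrI/oppr_inj/(mulfI nz_b).
suffices /card_gt0P[z] : (0 < #|A :&: B|)%N.
  rewrite inE => /andP[/imsetP[_ /imsetP[x _ ->] ->]].
  case/imsetP=> _ /imsetP[y _ ->] eq_xy.
  by exists x, y; rewrite eq_xy subrK.
rewrite -(ltn_add2l #|A :|: B|) addn0 cardsUI cardA cardB addnn -mul2n.
exact: leq_ltn_trans (max_card _) double_card_squares.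
Qed.

(* Three pairwise orthogonal vectors suffice, as a nondegenerate binary       *)
(* diagonal form represents every scalar.                                     *)
Lemma isotropic_vector (A : vectType F) (Q : A -> F) (B : A -> 'Hom(A, F^o)) :
    (forall a x, Q (a *: x) = a ^+ 2 * Q x) ->
    (forall x y, Q (x + y) = Q x + Q y + B x y) -> (4 < \dim {:A})%N ->
  exists2 x, x != 0 & Q x = 0.
Proof.
move=> QZ QD dimA.
have BC x y : B x y = B y x.
  by apply: (addrI (Q x + Q y)); rewrite -QD [in RHS](addrC (Q x)) -QD addrC.
have dim_lker x : (\dim {:A} <= (\dim (lker (B x))).+1)%N.
  rewrite -(limg_ker_dim (B x) fullv) capfv -addn1 leq_add2l.
  by rewrite -[leqRHS](dimvf (F^o : vectType F)) dimvS ?subvf.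
have pick_out (U W : {vspace A}) :
    (\dim W < \dim U)%N -> exists2 x, x \in U & x \notin W.
  move=> ltWU; have: ~~ (U <= W)%VS.
    by apply/negP => /dimvS; rewrite leqNgt ltWU.
  by case/subvPn=> x Ux nWx; exists x.
have [|t _ nt] := pick_out {:A}%VS 0%VS; first by rewrite dimv0 (leq_trans _ dimA).
rewrite memv0 in nt.
have [Qt0|nz_Qt] := eqVneq (Q t) 0; first by exists t.
have [|u Bu nu] := pick_out (lker (B t)) <[t]>%VS.
  rewrite dim_vline nt -ltnS; apply: leq_trans (dim_lker t).
  exact: leq_trans dimA.
have nz_u : u != 0 by apply: contraNneq nu => ->; rewrite mem0v.
have [Qu0|nz_Qu] := eqVneq (Q u) 0; first by exists u.
(* Each orthogonality condition costs at most one dimension, so at least 3 remain out of 5. Taking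
   [v] outside the span of [t] and [u] keeps the final vector nonzero even in characteristic 2,
   where [t] is orthogonal to itself. *)
have [|v] := pick_out (lker (B t) :&: lker (B u))%VS (<[t]> + <[u]>)%VS.
  apply: (@leq_ltn_trans 2).
    apply: leq_trans (dimv_add_leqif _ _).1 _.
    by rewrite !dim_vline; case: (t != 0); case: (u != 0).
  have := dimv_sum_cap (lker (B t)) (lker (B u)).
  have := dimvS (subvf (lker (B t) + lker (B u))%VS).
  have := dim_lker t; have := dim_lker u.
  lia.
rewrite memv_cap !memv_ker => /andP[/eqP Btv /eqP Buv] nv.
have [x [y Dxy]] := binary_form_onto (- Q v) nz_Qt nz_Qu.
exists (x *: t + y *: u + v).
  apply: contraNneq nv => /eqP; rewrite addr_eq0 => /eqP Dv.
  by rewrite -[v]opprK -Dv rpredN memv_add ?memvZ ?memv_line.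
move: Bu; rewrite memv_ker => /eqP Btu.
rewrite !QD !QZ [B _ v]BC linearD !linearZ /= BC linearZ /= !(BC _ t) !(BC _ u).
rewrite Btv Buv [B u t]BC Btu !scaler0 !addr0 mulrC [y ^+ 2 * _]mulrC Dxy addNr.
by [].
Qed.

(** The form is the coordinate on a complementary line, taken after projecting along [W]. *)
Lemma hyperplane_lker (K : fieldType) (A : vectType K) (W : {vspace A}) :
  (\dim W).+1 = \dim {:A} -> exists phi : 'Hom(A, K^o), lker phi = W.
Proof.
move=> dimW; set C := (W^C)%VS.
have dimC : \dim C = 1%N by rewrite dimv_compl -dimW subSnn.
pose i0 : 'I_(\dim C) := cast_ord (esym dimC) ord0.
pose phi : 'Hom(A, K^o) :=
  (linfun (coord (vbasis C) i0 : A -> K^o) \o daddv_pi C W)%VF.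
exists phi; apply/vspaceP=> x; rewrite memv_ker lfunE /= lfunE /=.
have dxCW : (C :&: W = 0)%VS by rewrite capvC capv_compl.
have dxWC : (W :&: C = 0)%VS by rewrite capv_compl.
have Cx : daddv_pi C W x \in C by apply: memv_pi.
have x_CW : x \in (C + W)%VS by rewrite addvC addv_complf memvf.
rewrite -{2}(daddv_pi_add dxCW x_CW) rpredDr ?memv_pi //.
transitivity (daddv_pi C W x == 0).
  apply/eqP/eqP => [c0|->]; last by rewrite linear0.
  rewrite (coord_vbasis Cx) big1 // => i _; rewrite (_ : i = i0) ?c0 ?scale0r //.
  by apply: (can_inj (cast_ordK dimC)); rewrite !ord1.
by rewrite -memv0 -dxWC memv_cap Cx andbT.
Qed.

End QuadraticForms.

(** * Collisions of Lunardon-Polverino maps *)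

Section LunardonPolverinoCollisions.

Variables (F : finFieldType) (L : fieldExtType F) (theta : {rmorphism L -> L}).
Local Notation n := (\dim {:L}).
Local Notation theta' := (iter n.-1 theta).
Hypotheses (n_odd : odd n) (n_gt4 : (4 < n)%N)
  (thetaF : forall a : F, theta a%:A = a%:A)
  (fixF : forall x, theta x = x -> x \in 1%VS)
  (thetan : forall x, iter n theta x = x).

Lemma automorphism_scale (a : F) x : theta (a *: x) = a *: theta x.
Proof. by rewrite -mulr_algl rmorphM thetaF mulr_algl. Qed.

Lemma iter_rmorphM i x y : iter i theta (x * y) = iter i theta x * iter i theta y.
Proof. by elim: i => //= i ->; rewrite rmorphM. Qed.

Lemma iter_rmorphB i x y : iter i theta (x - y) = iter i theta x - iter i theta y.
Proof. by elim: i => //= i ->; rewrite rmorphB. Qed.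

Lemma iter_rmorph1 i : iter i theta 1 = 1.
Proof. by elim: i => //= i ->; rewrite rmorph1. Qed.

Lemma iter_rmorph_eq0 i x : (iter i theta x == 0) = (x == 0).
Proof. by elim: i => //= i <-; rewrite fmorph_eq0. Qed.

Lemma theta'_theta x : theta' (theta x) = x.
Proof. by rewrite -iterSr prednK ?thetan // (leq_trans _ n_gt4). Qed.

(* The image of [theta - 1] is a hyperplane, so this is the isotropy of the   *)
(* quadratic form [t |-> phi (t * theta t)], with [phi] a linear form of that *)
(* kernel.                                                                    *)
Lemma twisted_square_coboundary :
  exists t w, t != 0 /\ theta w - w = t * theta t.
Proof.
have thZ : scalable theta by move=> a x; apply: automorphism_scale.
pose thzM := GRing.isScalable.Build _ _ _ _ (theta : L -> L) thZ.
pose thL : {linear L -> L} := HB.pack (theta : L -> L) theta thzM.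
pose T : 'End(L) := linfun thL; have TE x : T x = theta x by rewrite lfunE.
pose D : 'End(L) := (T - \1)%VF.
have DE x : D x = theta x - x by rewrite !lfunE /= opp_lfunE id_lfunE TE.
have kerD : lker D = 1%VS.
  apply/vspaceP=> x; rewrite memv_ker DE subr_eq0.
  by apply/eqP/idP => [/fixF //|/vlineP[a ->]]; apply: thetaF.
have [|phi kerphi] := @hyperplane_lker F L (limg D).
  by have := limg_ker_dim D fullv; rewrite capfv kerD dimv1 add1n.
pose Q (t : L) : F := phi (t * theta t).
pose B (x : L) := (phi \o (amull x \o T + amull (T x)))%VF.
have BE x y : B x y = phi (x * theta y + theta x * y).
  by rewrite comp_lfunE add_lfunE comp_lfunE /amull !lfunE /=.
have [||//|t nz_t Qt0] := @isotropic_vector F L Q B.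
- move=> a x; rewrite /Q automorphism_scale -scalerAl -scalerAr scalerA linearZ.
  by rewrite expr2.
- move=> x y; rewrite /Q BE rmorphD.
  have -> : (x + y) * (theta x + theta y) =
      x * theta x + y * theta y + (x * theta y + theta x * y) by ring.
  by rewrite !linearD.
have : t * theta t \in limg D by rewrite -kerphi memv_ker; apply/eqP.
by case/memv_imgP=> w _ Dw; exists t, w; rewrite -DE -Dw.
Qed.

(** As [theta'] inverts [theta], the collision equation in two unknowns becomes
    [theta' E = delta * E] for the twisted Wronskian [E]. *)
Lemma theta'_wronskian (delta y z : L) (E := y * theta z - z * theta y) :
  theta' E - delta * E =
  z * (delta * theta y + theta' y) - y * (delta * theta z + theta' z).
Proof. by rewrite /E iter_rmorphB !iter_rmorphM !theta'_theta; ring. Qed.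

Lemma LP_collisions (delta : L) :
  (forall y z, y != 0 ->
      z * (delta * theta y + theta' y) = y * (delta * theta z + theta' z) ->
    exists a : F, z = a *: y) <->
  (forall x, theta' x = delta * theta x -> x = 0).
Proof.
split=> [inj x Dx|inj y z nz_y eq_yz].
  have [//|nz_x] := eqVneq x 0.
  have [t [w [nz_t Dw]]] := twisted_square_coboundary.
  have nz_tt : theta t != 0 by rewrite fmorph_eq0.
  have nz_xx : theta x != 0 by rewrite fmorph_eq0.
  (* With [z = y * w] the Wronskian is [y * theta y * (theta w - w)]; dividing [x] by [t] turns it
     into [x * theta x]. *)
  pose y := x / t.
  have nz_y : y != 0 by rewrite mulf_neq0 ?invr_eq0.
  pose E := y * theta (y * w) - y * w * theta y.
  have DE : E = x * theta x.
    rewrite /E rmorphM fmorph_div /y.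
    transitivity (x * theta x * (theta w - w) / (t * theta t)).
      by field; apply/andP.
    by rewrite Dw mulfK // mulf_neq0.
  have theta'E : theta' E = delta * E.
    by rewrite DE iter_rmorphM theta'_theta Dx; ring.
  have [|a Da] := inj y (y * w) nz_y.
    by apply/eqP; rewrite -subr_eq0 -theta'_wronskian -/E theta'E subrr.
  (* Proportionality over [F] would put [w] in [F], where [theta w - w] vanishes, whereas
     [t * theta t] does not. *)
  have Dwa : w = a%:A by apply: (mulfI nz_y); rewrite Da mulr_algr.
  move: Dw; rewrite Dwa thetaF subrr => /esym/eqP.
  by rewrite mulf_eq0 (negPf nz_t) (negPf nz_tt).
pose E := y * theta z - z * theta y.
have theta'E : theta' E = delta * E.
  by apply/eqP; rewrite -subr_eq0 theta'_wronskian eq_yz subrr.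
have E0 : E = 0.
  (* The even iterates, with exponents 0, 2, ..., n - 1. Applying [theta] gives the odd exponents up
     to [n], the last factor being [E] again; applying [theta'] gives [theta' E = delta * E] and the
     odd exponents up to n - 2. So [theta' x = delta * theta x]. *)
  pose x := \prod_(i < n./2.+1) iter (i + i) theta E.
  have nz_x : x = 0.
    apply: inj; rewrite /x rmorph_prod [in RHS]big_ord_recr /=.
    have nE : (n./2 + n./2).+1 = n by rewrite addnn -[RHS]odd_double_half n_odd.
    rewrite -iterS nE thetan.
    rewrite (big_morph _ (iter_rmorphM _) (iter_rmorph1 _)) big_ord_recl /=.
    rewrite theta'E -mulrA [E * _]mulrC; congr (_ * (_ * _)).
    apply: eq_bigr => i _; rewrite theta'_theta add0n /bump /= add1n addnS.
    by rewrite iterS.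
  apply/eqP; move/eqP: nz_x; rewrite prodf_seq_eq0 => /hasP[i _].
  by rewrite iter_rmorph_eq0.
have /fixF/vlineP[a Da] : theta (z / y) = z / y.
  apply/eqP; rewrite fmorph_div eqr_div ?fmorph_eq0 //.
  by rewrite -subr_eq0 mulrC -/E E0.
by exists a; rewrite -mulr_algl -Da divfK.
Qed.

End LunardonPolverinoCollisions.

(** * Scattered linear sets *)

Section MaximumScattered.

Variables (F : finFieldType) (L : fieldExtType F) (V : vectType L).
Local Notation V0 := (scalar_restr V).
Implicit Types (U : {vspace V0}) (W : {vspace V}).

Definition scattered U := forall u v : V, (u : V0) \in U -> (v : V0) \in U ->
  u != 0 -> v != 0 -> <[u]>%VS = <[v]>%VS -> exists a : F, v = a *: (u : V0).

Lemma vline_restr_scale (a : F) (u : V) :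
  a != 0 -> <[(a *: (u : V0)) : V]>%VS = <[u]>%VS.
Proof.
move=> nz_a; rewrite scalar_restr_scaleE.
have nz_aA : a%:A != 0 :> L by rewrite scaler_eq0 oner_eq0 orbF.
apply/eqP; rewrite eqEsubv -!memvE memvZ ?memv_line //=.
by rewrite -{1}[u](scalerK nz_aA) memvZ // memv_line.
Qed.

Lemma scatteredP U :
  scattered U <-> (forall P, linear_set U P -> weight U P = 1%N).
Proof.
split=> [scU _ [u [Uu nz_u] <-]|wU u v Uu Uv nz_u nz_v eq_uv].
  rewrite /weight; suffices -> : (U :&: vrestr <[u]> = <[u : V0]>)%VS.
    by rewrite dim_vline nz_u.
  apply/vspaceP=> v; rewrite memv_cap mem_vrestr.
  apply/andP/idP => [[Uv u_v]|]; last first.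
    case/vlineP=> a ->; split; first exact: memvZ.
    by rewrite scalar_restr_scaleE memvZ // memv_line.
  have [->|nz_v] := eqVneq v 0; first exact: mem0v.
  have [|a ->] := scU u v Uu Uv nz_u nz_v; last by rewrite memvZ // memv_line.
  apply/esym/eqP; rewrite eqEdim -memvE u_v !dim_vline nz_u.
  by rewrite (_ : v != 0).
have dim1 : \dim (U :&: vrestr <[u]>)%VS = 1%N by apply: wU; exists u.
have : (v : V0) \in (U :&: vrestr <[u]>)%VS.
  by rewrite memv_cap Uv mem_vrestr eq_uv memv_line.
suffices <- : <[u : V0]>%VS = (U :&: vrestr <[u]>)%VS by case/vlineP=> a ->; exists a.
apply/eqP; rewrite eqEdim dim1 dim_vline nz_u andbT -memvE memv_cap Uu.
by rewrite mem_vrestr memv_line.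
Qed.

(* Sending the multiple [c *: u'] of a chosen generator [u'] of a point to    *)
(* [c *: u] embeds the scattered [U'] into [U], hence onto it.                *)
Lemma scattered_same_points U U' :
  \dim U = \dim U' -> linear_set U = linear_set U' ->
  scattered U' -> scattered U.
Proof.
move=> eq_dim eq_set scU'; pose T := finvect_type V0.
pose gen (A : {vspace V0}) (P : {vspace V}) : V0 :=
  xget 0 [set u : V0 | u \in A /\ <[u : V]>%VS = P].
have genP A P : linear_set A P ->
    [/\ gen A P \in A, gen A P != 0 & <[gen A P : V]>%VS = P].
  case=> u [Au nz_u] DP.
  have [|Ag Dg] := @xgetPex _ 0 [set u : V0 | u \in A /\ <[u : V]>%VS = P].
    by exists u.
  split=> //; apply: contraNneq nz_u => g0.
  by rewrite -memv0 -(span_seq1 0) span_seq1 -[0]g0 Dg -DP memv_line.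
have lin (A : {vspace V0}) (u : V0) : u \in A -> u != 0 -> linear_set A <[u : V]>%VS.
  by move=> Au nz_u; exists u.
pose c (u : V0) : F := xget 0 [set a | u = a *: gen U' <[u : V]>%VS].
have cP (u : V0) : u \in U' -> u != 0 ->
    u = c u *: gen U' <[u : V]>%VS /\ c u != 0.
  move=> Uu nz_u; have [Ug nz_g Dg] := genP _ _ (lin _ _ Uu nz_u).
  have Du : u = c u *: gen U' <[u : V]>%VS.
    apply: (@xgetPex _ 0 [set a | u = a *: gen U' <[u : V]>%VS]).
    exact: scU' Ug Uu nz_g nz_u Dg.
  split=> //; apply: contraNneq nz_u => c0.
  by rewrite Du c0 scale0r.
pose h (u : T) : T := c u *: gen U <[u : V]>%VS.
have hP (u : V0) : u \in U' -> u != 0 ->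
    [/\ h u \in U, h u != 0 & <[h u : V]>%VS = <[u : V]>%VS].
  move=> Uu nz_u; have [_ nz_c] := cP _ Uu nz_u.
  have /genP[Ug nz_g Dg] : linear_set U <[u : V]>%VS by rewrite eq_set; apply: lin.
  split; first exact: memvZ.
    by rewrite scaler_eq0 negb_or nz_c.
  by rewrite [X in <[X]>%VS](_ : _ = c u *: gen U <[u : V]>%VS) // vline_restr_scale.
(* Only 0 generates the zero line, so the generator chosen there is 0. *)
have h0 : h 0 = 0.
  have [|_ Dg] := @xgetPex _ 0 [set u : V0 | u \in U /\ <[u : V]>%VS = <[0 : V]>%VS].
    by exists 0; split; first exact: mem0v.
  have g0 : gen U <[0 : V]>%VS = 0.
    have : (<[gen U <[0 : V]> : V]> <= <[0 : V]>)%VS by rewrite /gen Dg.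
    by rewrite -memvE => /vlineP[b]; rewrite scaler0.
  by apply: (etrans _ (scaler0 _ _)); congr (_ *: _); apply: g0.
have h_inj : {in [set u : T | (u : V0) \in U']%SET &, injective h}.
  move=> u v; rewrite !inE => Uu Uv eq_h.
  have [u0|nz_u] := eqVneq (u : V0) 0.
    have [-> //|nz_v] := eqVneq (v : V0) 0.
    have [_ /eqP[]] := hP v Uv nz_v.
    by rewrite -eq_h u0.
  have [v0|nz_v] := eqVneq (v : V0) 0.
    have [_ /eqP[]] := hP u Uu nz_u.
    by rewrite eq_h v0.
  have [_ nz_h Du] := hP u Uu nz_u; have [_ _ Dv] := hP v Uv nz_v.
  have eq_uv : <[u : V]>%VS = <[v : V]>%VS by rewrite -Du -Dv eq_h.
  have [Eu _] := cP u Uu nz_u; have [Ev _] := cP v Uv nz_v.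
  suffices eq_c : c u = c v by rewrite Eu Ev eq_c eq_uv.
  move: nz_h eq_h; rewrite /h -eq_uv scaler_eq0 negb_or => /andP[_ nz_g] /eqP.
  by rewrite -subr_eq0 -scalerBl scaler_eq0 (negPf nz_g) orbF subr_eq0 => /eqP.
have cardE (A : {vspace V0}) : #|[set u : T | (u : V0) \in A]%SET| = (#|F| ^ \dim A)%N.
  by rewrite cardsE; apply: (@card_vspace F T _ (A : {vspace T})).
have hU : (h @: [set u : T | (u : V0) \in U'] = [set u : T | (u : V0) \in U])%SET.
  apply/eqP; rewrite eqEcard card_in_imset // !cardE eq_dim leqnn andbT.
  apply/fintype.subsetP=> x /imsetP[u]; rewrite !inE => Uu ->.
  have [->|nz_u] := eqVneq (u : V0) 0; first by rewrite h0 mem0v.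
  by have [] := hP u Uu nz_u.
move=> u v Uu Uv nz_u nz_v eq_uv.
have pre (w : V0) : w \in U -> w != 0 -> exists a, w = a *: gen U <[w : V]>%VS.
  move=> Uw nz_w.
  have : (w : T) \in (h @: [set u : T | (u : V0) \in U'])%SET by rewrite hU inE.
  case/imsetP=> x; rewrite inE => Ux Dw; exists (c x).
  have nz_x : (x : V0) != 0.
    by apply: contraNneq nz_w => x0; rewrite Dw x0 h0.
  by have [_ _ Dx] := hP x Ux nz_x; rewrite {2}Dw Dx.
have [a Du] := pre u Uu nz_u; have [b Dv] := pre v Uv nz_v.
have nz_a : a != 0 by apply: contraNneq nz_u => a0; rewrite Du a0 scale0r.
by exists (b / a); rewrite Du Dv eq_uv scalerA divfK.
Qed.

(** [max_scattered] only provides some subspace defining the point set; [scattered_same_points]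
    transfers scatteredness from it to the given subspace [G @: S], on which [G] is injective. *)
Lemma max_scatteredP (A : vectType F) (S : {vspace A}) (G : 'Hom(A, V0)) W :
    \dim S = \dim {:L} -> (S :&: lker G = 0)%VS -> (G @: S <= vrestr W)%VS ->
  max_scattered W [set <[G x : V]>%VS | x in [set x | x \in S /\ x != 0]] <->
  (forall x y, x \in S -> y \in S -> x != 0 -> y != 0 ->
     <[G x : V]>%VS = <[G y : V]>%VS -> exists a : F, y = a *: x).
Proof.
move=> dimS kerG subW.
have G0 x : x \in S -> (G x == 0) = (x == 0).
  move=> Sx; apply/eqP/eqP => [Gx0|->]; last exact: linear0.
  by apply/eqP; rewrite -memv0 -kerG memv_cap Sx memv_ker Gx0 eqxx.
have G_inj x y : x \in S -> y \in S -> G x = G y -> x = y.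
  move=> Sx Sy eqG; apply/eqP; rewrite -subr_eq0 -G0 ?rpredB //.
  by rewrite linearB /= eqG subrr.
have dimU : \dim (G @: S) = \dim {:L} by rewrite limg_dim_eq.
have -> : [set <[G x : V]>%VS | x in [set x | x \in S /\ x != 0]]
    = linear_set (G @: S)%VS.
  apply/seteqP; split=> [_ [x [Sx nz_x] <-]|_ [_ [/memv_imgP[x Sx ->] nz_x] <-]].
    by exists (G x) => //; split; [apply: memv_img|rewrite G0].
  by exists x => //; split=> //; rewrite -G0.
split=> [[U [_ dimU' eqU wU]] x y Sx Sy nz_x nz_y eq_xy|sc].
  have scU : scattered U by apply/scatteredP; rewrite -eqU.
  have [||a Ga] := scattered_same_points (etrans dimU (esym dimU')) eqU scU
    (memv_img G Sx) (memv_img G Sy) _ _ eq_xy; rewrite ?G0 //.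
  by exists a; apply: G_inj; rewrite ?memvZ // linearZ.
exists (G @: S)%VS; split=> //; apply/scatteredP.
move=> _ _ /memv_imgP[x Sx ->] /memv_imgP[y Sy ->].
rewrite !G0 // => nz_x nz_y eq_xy.
by have [a ->] := sc x y Sx Sy nz_x nz_y eq_xy; exists a; rewrite linearZ.
Qed.

End MaximumScattered.

(** * Collineations fixing a canonical subgeometry *)

Section Frames.

Variables (F : finFieldType) (L : fieldExtType F) (V : vectType L) (n : nat).
Variables (Sigma : set {vspace V}) (S : {vspace scalar_restr V}) (e : n.-tuple V).
Variables (i0 i1 : 'I_n).
Hypotheses (ne_i10 : i1 != i0) (eB : basis_of fullv e)
  (SE : forall u : V, (u : scalar_restr V) \in S <->
     forall i, coord e i u \in 1%VS)
  (SigmaE : Sigma = linear_set S).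

Let coord_e (i j : 'I_n) : coord e i e`_j = if j == i then 1 else 0.
Proof. by rewrite coord_free ?(basis_free eB) //; case: (j == i). Qed.

Let mem_e (i j : 'I_n) : coord e i e`_j \in 1%VS.
Proof. by rewrite coord_e; case: ifP; rewrite ?mem1v ?mem0v. Qed.

Let e_neq0 (i : 'I_n) : e`_i != 0.
Proof.
apply/eqP => ei0; have := coord_e i i; rewrite ei0 linear0 eqxx => /eqP.
by rewrite eq_sym oner_eq0.
Qed.

(** Points of this pencil determine their parameter, so the action of a collineation on them reveals
    its field automorphism. *)
Lemma frame_pencil_inj x y :
  e`_i0 + x *: e`_i1 \in <[(e`_i0 + y *: e`_i1)%R]>%VS -> x = y.
Proof.
case/vlineP=> c Dc; have c1 := congr1 (coord e i0) Dc.
have cx := congr1 (coord e i1) Dc; move: c1 cx.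
rewrite !linearZ /= !linearD /= !linearZ /= !coord_e !eqxx (negPf ne_i10).
rewrite [i0 == i1]eq_sym (negPf ne_i10) !mulr0 !mulr1 !addr0 !add0r mulr1 => <-.
by rewrite mul1r.
Qed.

Lemma frame_point u : u != 0 -> (forall i, coord e i u \in 1%VS) -> Sigma <[u]>%VS.
Proof. by move=> nz_u /SE Su; rewrite SigmaE; exists u. Qed.

Lemma frame_pencil_point (a : F) : Sigma <[(e`_i0 + a%:A *: e`_i1)%R]>%VS.
Proof.
apply: frame_point => [|i]; last first.
  rewrite linearD linearZ rpredD ?rpredM ?mem_e //.
  by rewrite memvZ // memv_line.
apply/eqP => /(congr1 (coord e i0)).
rewrite linearD linearZ linear0 /= !coord_e eqxx (negPf ne_i10) mulr0 addr0 => /eqP.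
by rewrite oner_eq0.
Qed.

Lemma frame_vertex_point (i : 'I_n) : Sigma <[e`_i]>%VS.
Proof. by apply: frame_point => // j; apply: mem_e. Qed.

(** A semilinear map inducing [g] scales each frame vector; the points spanned by [e]_i0 + e[_i]
    force a common scalar [lam], which is divided out. The pencil points with parameter in [F] then
    force [theta] to fix [F]. *)
Lemma pointwise_stab_semilinear g : pointwise_stab Sigma g ->
  exists (theta : {rmorphism L -> L}) (f : V -> V),
  [/\ {morph f : u v / u + v}, forall a u, f (a *: u) = theta a *: f u,
      forall W, [set` g W] = f @` [set` W],
      forall i : 'I_n, f e`_i = e`_i & forall a : F, theta a%:A = a%:A].
Proof.
move=> [[theta [f [[_ fD fZ [_ fI _]] gE]] gS]].
have {}fD : {morph f : u v / u + v} by move=> u v; rewrite fD ?memvf.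
have {}fZ a u : f (a *: u) = theta a *: f u by rewrite fZ ?memvf.
have f0 : f 0 = 0 by rewrite -[X in f X](scale0r (0 : V)) fZ rmorph0 scale0r.
have f_eq0 u : f u = 0 -> u = 0.
  by move=> fu0; apply: fI; rewrite ?fu0 ?f0 // inE /= memvf.
have fixP u : Sigma <[u]>%VS -> exists c, f u = c *: u.
  move=> Su; apply/vlineP; have : [set` g <[u]>%VS] (f u).
    by rewrite gE; exists u => //; apply: memv_line.
  by rewrite gS.
have [lam Dlam] := fixP _ (frame_vertex_point i0).
have nz_lam : lam != 0.
  apply: contraTneq (e_neq0 i0) => lam0; rewrite negbK; apply/eqP/f_eq0.
  by rewrite Dlam lam0 scale0r.
have fe (i : 'I_n) : f e`_i = lam *: e`_i.
  have [mu Dmu] := fixP _ (frame_vertex_point i).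
  have [->//|ne_i] := eqVneq i i0.
  have [|nu] := fixP (e`_i0 + e`_i).
    apply: frame_point => [|j]; last by rewrite linearD rpredD ?mem_e.
    apply/eqP => /(congr1 (coord e i0)).
    rewrite linearD linear0 /= !coord_e eqxx (negPf ne_i) addr0 => /eqP.
    by rewrite oner_eq0.
  rewrite fD Dlam Dmu => Dnu.
  have := congr1 (coord e i0) Dnu; have := congr1 (coord e i) Dnu.
  rewrite !linearZ /= !linearD /= !linearZ /= !coord_e !eqxx (negPf ne_i).
  rewrite [i0 == i]eq_sym (negPf ne_i) !mulr0 !addr0 !add0r !mulr1.
  by move=> -> ->.
pose f1 u := lam^-1 *: f u; exists theta, f1.
have f1e (i : 'I_n) : f1 e`_i = e`_i by rewrite /f1 fe scalerA mulVf // scale1r.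
have f1D : {morph f1 : u v / u + v} by move=> u v; rewrite /f1 fD scalerDr.
have f1Z a u : f1 (a *: u) = theta a *: f1 u.
  by rewrite /f1 fZ !scalerA mulrC.
have g1E W : [set` g W] = f1 @` [set` W].
  apply/seteqP; split=> [v gv|_ [u Wu <-]].
    have : [set` g W] (lam *: v) by apply: memvZ.
    rewrite gE => -[u Wu Du]; exists u => //.
    by rewrite /f1 Du scalerA mulVf // scale1r.
  by apply: memvZ; have : [set` g W] (f u) by rewrite gE; exists u.
split=> // a; apply: frame_pencil_inj; rewrite -[X in X + _]f1e -[X in _ *: X]f1e.
rewrite -f1Z -f1D -(gS _ (frame_pencil_point a)).
set w := (_ + _); have : [set` g <[w]>%VS] (f1 w); last by [].
by rewrite g1E; exists w => //; apply: memv_line.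
Qed.

Definition frame_map (phi : {rmorphism L -> L}) (u : V) : V :=
  \sum_(i < n) phi (coord e i u) *: e`_i.

Lemma coord_frame_map phi i u : coord e i (frame_map phi u) = phi (coord e i u).
Proof. by rewrite coord_sum_free ?(basis_free eB). Qed.

Lemma frame_mapD phi : {morph frame_map phi : u v / u + v}.
Proof.
move=> u v; rewrite /frame_map -big_split; apply: eq_bigr => i _ /=.
by rewrite linearD rmorphD scalerDl.
Qed.

Lemma frame_mapZ phi a u : frame_map phi (a *: u) = phi a *: frame_map phi u.
Proof.
rewrite /frame_map scaler_sumr; apply: eq_bigr => i _.
by rewrite linearZ rmorphM scalerA.
Qed.

Lemma frame_mapK (phi : {rmorphism L -> L}) (phi' : L -> L) : cancel phi phi' ->
  cancel (frame_map phi) (fun u => \sum_(i < n) phi' (coord e i u) *: e`_i).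
Proof.
move=> phiK u; rewrite [RHS](coord_basis eB (memvf u)).
by apply: eq_bigr => i _; rewrite coord_frame_map phiK.
Qed.

Lemma frame_mapVK (phi : {rmorphism L -> L}) (phi' : L -> L) : cancel phi' phi ->
  cancel (fun u => \sum_(i < n) phi' (coord e i u) *: e`_i) (frame_map phi).
Proof.
move=> phiK u; rewrite [RHS](coord_basis eB (memvf u)) /frame_map.
by apply: eq_bigr => i _; rewrite coord_sum_free ?(basis_free eB) // phiK.
Qed.

(** Used with the Frobenius, to exhibit an element of the stabilizer against which the powers of a
    generator can be compared. *)
Lemma frame_map_stab (phi : {rmorphism L -> L}) (phi' : L -> L) :
    cancel phi phi' -> cancel phi' phi -> (forall a : F, phi a%:A = a%:A) ->
  exists g : {vspace V} -> {vspace V}, pointwise_stab Sigma g /\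
    forall W, [set` g W] = frame_map phi @` [set` W].
Proof.
move=> phiK phi'K phiF; set f := frame_map phi.
pose g (W : {vspace V}) := <<map f (vbasis W)>>%VS.
have fD : {morph f : u v / u + v} := @frame_mapD phi.
have fZ a u : f (a *: u) = phi a *: f u := frame_mapZ phi a u.
have f_sum := semilinear_sum fD fZ.
have gE W : [set` g W] = f @` [set` W].
  apply/seteqP; split=> [v|_ [u Wu <-]] /=.
    rewrite /g /= => /coord_span ->.
    exists (\sum_(i < \dim W) phi' (coord (map_tuple f (vbasis W)) i v) *: (vbasis W)`_i).
      rewrite /= rpred_sum // => i _.
      by rewrite memvZ // vbasis_mem // mem_nth ?size_tuple.
    rewrite f_sum; apply: eq_bigr => i _; rewrite phi'K; congr (_ *: _).
    by rewrite (nth_map 0) ?size_tuple.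
  rewrite (coord_vbasis Wu) f_sum rpred_sum // => i _.
  by rewrite memvZ // memv_span // map_f // mem_nth // size_tuple.
exists g; split=> //; split; last first.
  rewrite SigmaE => _ [u [/SE Fu nz_u] <-].
  have fu : f u = u.
    rewrite [RHS](coord_basis eB (memvf u)); apply: eq_bigr => i _.
    by have /vlineP[a ->] := Fu i; rewrite phiF.
  apply/vspaceP=> v; apply/idP/idP => [|/vlineP[a ->]].
    have gv : [set` g <[u]>%VS] v <-> (f @` [set` <[u]>%VS]) v by rewrite gE.
    by move/(proj1 gv) => [_ /vlineP[a ->] <-]; rewrite fZ fu memvZ ?memv_line.
  apply: memvZ; have gu : [set` g <[u]>%VS] u <-> (f @` [set` <[u]>%VS]) u by rewrite gE.
  by apply: (proj2 gu); exists u => //; apply: memv_line.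
exists phi, f; split; last exact: gE.
split; first by exists phi'.
- by move=> u v _ _; apply: fD.
- by move=> a u _; apply: fZ.
split=> [u _|u v _ _|u _]; first exact: memvf.
  exact: (can_inj (frame_mapK phiK)).
exists (\sum_(i < n) phi' (coord e i u) *: e`_i); first exact: memvf.
exact: frame_mapVK.
Qed.

(** The Frobenius collineation is a power of [sigma]; comparing both on a pencil shows that a power
    of [theta] is the Frobenius. Hence [s] is coprime to [n] and [theta] fixes nothing outside
    [F]. *)
Lemma generator_semilinear sigma : \dim {:L} = n -> generates_stab Sigma sigma ->
  exists (theta : {rmorphism L -> L}) (f : V -> V) (s : nat),
  [/\ {morph f : u v / u + v}, forall a u, f (a *: u) = theta a *: f u,
      forall W, [set` sigma W] = f @` [set` W] &
      forall i : 'I_n, f e`_i = e`_i] /\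
  [/\ forall a : F, theta a%:A = a%:A, (s < n)%N, coprime s n,
      forall x, theta x = x ^+ (#|F| ^ s) &
      forall x, theta x = x -> x \in 1%VS] /\
  [/\ forall x, iter n theta x = x & forall u, iter n f u = u].
Proof.
move=> dimL [stab_sigma gen]; have n_gt0 : (0 < n)%N by case: n i0 => // -[].
have [theta [f [fD fZ sE fe thF]]] := pointwise_stab_semilinear stab_sigma.
have [s lt_sn thE] := rmorphism_frobenius_power thF.
have thn x : iter n theta x = x.
  have iterE k : iter k theta x = x ^+ (#|F| ^ (k * s)).
    by elim: k => [|k /= ->]; rewrite ?mul0n // thE -exprM -expnD mulSnr.
  rewrite iterE; elim: s {lt_sn thE iterE} => [|s IHs]; first by rewrite muln0.
  by rewrite mulnS expnD exprM -{1}dimL expf_card_ext IHs.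
have coord_iter k i u : coord e i (iter k f u) = iter k theta (coord e i u).
  by elim: k => //= k IHk; rewrite (coord_semilinear fD fZ eB fe) IHk.
have fn u : iter n f u = u.
  rewrite [RHS](coord_basis eB (memvf u)) [LHS](coord_basis eB (memvf _)).
  by apply: eq_bigr => i _; rewrite coord_iter thn.
have [phi phiE] := exists_frobenius L.
pose phi' (x : L) := x ^+ (#|F| ^ n.-1).
have phiK : cancel phi phi'.
  by move=> x; rewrite /phi' phiE -exprM -expnS prednK // -dimL expf_card_ext.
have phi'K : cancel phi' phi.
  by move=> x; rewrite /phi' phiE -exprM -expnSr prednK // -dimL expf_card_ext.
have phiF (a : F) : phi a%:A = a%:A.
  by apply/eqP; rewrite phiE -mem1v_frobenius memvZ // memv_line.
have [g [stab_g gE]] := frame_map_stab phiK phi'K phiF.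
have [k Dg] := gen g stab_g.
have iterE x : iter k theta x = phi x.
  pose w := e`_i0 + x *: e`_i1.
  have : [set` g <[w]>%VS] (frame_map phi w).
    by rewrite gE; exists w => //; apply: memv_line.
  rewrite Dg (semilinear_iter_vline fZ n_gt0 fn sE) /=.
  have -> : iter k f w = e`_i0 + iter k theta x *: e`_i1.
    by elim: k {Dg} => // k /= ->; rewrite fD fZ !fe.
  have -> : frame_map phi w = e`_i0 + phi x *: e`_i1.
    rewrite frame_mapD frame_mapZ.
    have fme (i : 'I_n) : frame_map phi e`_i = e`_i.
      rewrite [RHS](coord_basis eB (memvf _)); apply: eq_bigr => j _.
      by rewrite coord_e; case: ifP => _; rewrite ?rmorph1 ?rmorph0.
    by rewrite !fme.
  by move/frame_pencil_inj.
exists theta, f, s; split=> //; split=> //; split=> //; first by rewrite -dimL.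
  rewrite -dimL; apply: (frobenius_power_coprime thE (k := k)); last by rewrite dimL.
  by move=> x; rewrite iterE phiE.
move=> x thx; rewrite mem1v_frobenius -phiE -iterE; apply/eqP.
by elim: k {iterE Dg} => //= k ->.
Qed.

End Frames.

(** * Projections of a subgeometry *)

Section Projections.

Variables (F : finFieldType) (L : fieldExtType F) (V : vectType L).

(** An [F]-basis of [S] spans [V] over [L] and has [\dim {:V}] elements, so it is also an
    [L]-basis. *)
Lemma canonical_subgeometry_frame (Sigma : set {vspace V}) n :
    \dim {:V} = n -> canonical_subgeometry Sigma ->
  exists (S : {vspace scalar_restr V}) (e : n.-tuple V),
  [/\ \dim S = n, basis_of fullv e, Sigma = linear_set S &
      forall u : V, (u : scalar_restr V) \in S <->
        forall i, coord e i u \in 1%VS].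
Proof.
move=> dimV [S [dimS spanS SigmaE]].
move: n dimV; rewrite -dimS => _ <-.
pose e : (\dim S).-tuple V := vbasis S; exists S, e.
have eS (i : 'I_(\dim S)) : (e`_i : scalar_restr V) \in S.
  by rewrite vbasis_mem // mem_nth // size_tuple.
have SE (u : V) : (u : scalar_restr V) \in S ->
    exists c : 'I_(\dim S) -> F, u = \sum_i (c i)%:A *: e`_i.
  by move=> Su; exists (coord (vbasis S) ^~ u); exact: (coord_vbasis Su).
have eB : basis_of fullv e.
  rewrite basisEdim size_tuple -[leqRHS]dimS leqnn andbT.
  suffices -> : <<e>>%VS = fullv by [].
  apply: spanS => u /SE[c ->]; apply: (@memv_suml L V) => i _.
  by rewrite memvZ // memv_span // mem_nth // size_tuple.
split=> // u; split=> [/SE[c ->] i|Fu].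
  by rewrite coord_sum_free ?(basis_free eB) // memvZ // memv_line.
rewrite (coord_basis eB (memvf u)); apply: (@memv_suml F (scalar_restr V)) => i _.
by have /vlineP[a ->] := Fu i; rewrite -scalar_restr_scaleE memvZ // eS.
Qed.

Variables (Gamma Lambda : {vspace V}).
Hypotheses (dim_sum : (\dim Gamma + \dim Lambda)%N = \dim {:V})
  (dx : (Lambda :&: Gamma)%VS = 0%VS).

Local Notation pi := (daddv_pi Lambda Gamma).

Lemma memv_sub_proj u : u - pi u \in Gamma.
Proof.
have u_sum : u \in (Lambda + Gamma)%VS.
  suffices -> : (Lambda + Gamma)%VS = fullv by apply: memvf.
  apply/eqP; rewrite eqEdim subvf /= -dim_sum dimv_disjoint_sum //.
  by rewrite addnC.
by rewrite -{1}(daddv_pi_add dx u_sum) addrC addKr memv_pi.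
Qed.

Lemma proj_eq0 u : (pi u == 0) = (u \in Gamma).
Proof.
apply/eqP/idP => [pu0|Gu]; first by have := memv_sub_proj u; rewrite pu0 subr0.
have : pi u \in (Lambda :&: Gamma)%VS.
  by rewrite memv_cap memv_pi -[pi u](subKr u) rpredB // memv_sub_proj.
by rewrite dx memv0 => /eqP.
Qed.

Lemma projection_point u : ((Gamma + <[u]>) :&: Lambda)%VS = <[pi u]>%VS.
Proof.
apply/vspaceP=> v; rewrite memv_cap; apply/andP/vlineP => [[]|[a ->]].
  move=> /memv_addP[w Gw [_ /vlineP[a ->] ->]] Lv; exists a.
  rewrite -[LHS](daddv_pi_id dx Lv) linearD linearZ /=.
  by move: Gw; rewrite -proj_eq0 => /eqP->; rewrite add0r.
split; last by rewrite memvZ // memv_pi.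
rewrite memvZ // -[pi u](subrK u) memv_add ?memv_line //.
by rewrite -opprB rpredN memv_sub_proj.
Qed.

(** Two points have the same image exactly when some combination [y - c *: x] lies in the vertex
    [Gamma]; disjointness from [Sigma] makes the projection injective on [S], so [max_scatteredP]
    applies. *)
Lemma projection_max_scattered (Sigma : set {vspace V})
    (S : {vspace scalar_restr V}) :
    \dim S = \dim {:L} -> Sigma = linear_set S ->
    points Gamma `&` Sigma = set0 ->
  max_scattered Lambda (projection Gamma Lambda Sigma) <->
  (forall x y : scalar_restr V, x \in S -> y \in S -> x != 0 -> y != 0 ->
     forall c : L, (y : V) - c *: (x : V) \in Gamma -> exists a : F, y = a *: x).
Proof.
move=> dimS SigmaE GSigma.
have SG0 (x : scalar_restr V) : x \in S -> (x : V) \in Gamma -> x = 0.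
  move=> Sx Gx; apply/eqP; have [//|nz_x] := eqVneq x 0.
  suffices : (points Gamma `&` Sigma) <[x : V]>%VS by rewrite GSigma.
  split; first by rewrite /points /= dim_vline (_ : (x : V) != 0) // -memvE.
  by rewrite SigmaE; exists x.
pose p : scalar_restr V -> scalar_restr V := pi.
have pD : zmod_morphism p by move=> x y; apply: (linearB pi).
have pZ : scalable p by move=> a x; apply: (linearZ_LR pi).
pose pDM := GRing.isZmodMorphism.Build _ _ p pD.
pose pZM := GRing.isScalable.Build _ _ _ _ p pZ.
pose pL : {linear scalar_restr V -> scalar_restr V} := HB.pack p pDM pZM.
pose G := linfun pL; have GE x : G x = pi x by rewrite lfunE.
have -> : projection Gamma Lambda Sigma =
    [set <[G x : V]>%VS | x in [set x | x \in S /\ x != 0]].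
  apply/seteqP; split=> [_ [X SX <-]|_ [x [Sx nz_x] <-]].
    move: SX; rewrite SigmaE => -[x [Sx nz_x] <-]; exists x => //.
    by rewrite projection_point GE.
  exists <[x : V]>%VS; first by rewrite SigmaE; exists x.
  by rewrite projection_point GE.
have nzG x : x \in S -> x != 0 -> pi x != 0.
  by move=> Sx; apply: contraNN; rewrite proj_eq0 => /(SG0 _ Sx)->.
rewrite (@max_scatteredP F L V (scalar_restr V) S G Lambda dimS); last 2 first.
- apply/eqP; rewrite -subv0; apply/subvP=> x; rewrite memv_cap memv_ker GE memv0.
  by case/andP=> Sx; have [//|/(nzG _ Sx)/negPf->] := eqVneq x 0.
- by apply/subvP=> _ /memv_imgP[x _ ->]; rewrite GE mem_vrestr memv_pi.
split=> sc x y Sx Sy nz_x nz_y => [c Gyx|eq_xy].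
  apply: sc => //; rewrite !GE.
  have Dy : pi y = c *: pi x.
    by apply/eqP; rewrite -subr_eq0 -linearZ -linearB proj_eq0.
  apply/esym/eqP; rewrite eqEdim !dim_vline nzG // nzG // andbT -memvE Dy.
  by rewrite memvZ // memv_line.
have : pi y \in <[pi x]>%VS by rewrite -!GE eq_xy memv_line.
case/vlineP=> c Dy; apply: (sc x y Sx Sy nz_x nz_y c).
by rewrite -proj_eq0 linearB linearZ /= Dy subrr.
Qed.

End Projections.

(** * The conjugates of a point *)

Section ConjugatesOfThePoint.

Variables (K : fieldType) (V : vectType K) (n : nat) (theta : {rmorphism K -> K}).
Variable f : V -> V.
Hypotheses (fD : {morph f : u v / u + v})
  (fZ : forall a u, f (a *: u) = theta a *: f u)
  (n_gt4 : (4 < n)%N) (fn : forall u, iter n f u = u).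

Let n_gt0 : (0 < n)%N := leq_trans (isT : 0 < 5)%N n_gt4.

Lemma iter_modn i u : iter i f u = iter (i %% n)%N f u.
Proof.
rewrite {1}(divn_eq i n) addnC iterD; congr (iter _ _ _).
by elim: (i %/ n)%N => // k IHk; rewrite mulSn iterD IHk.
Qed.

Lemma iter_addn i u : iter (i + n) f u = iter i f u.
Proof. by rewrite iterD fn. Qed.

Variable r : V.

Definition conjugate_span := <<mkseq (fun i => iter i f r) n>>%VS.
Local Notation H := conjugate_span.

Lemma mem_conjugate_span i : iter i f r \in H.
Proof.
rewrite iter_modn; apply: memv_span; apply/mapP; exists (i %% n)%N => //.
by rewrite mem_iota ltn_mod.
Qed.

Lemma conjugate_span_subv (W : {vspace V}) :
  (forall i, (i < n)%N -> iter i f r \in W) -> (H <= W)%VS.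
Proof.
move=> rW; apply/span_subvP=> _ /mapP[i lt_in ->]; apply: rW.
by move: lt_in; rewrite mem_iota.
Qed.

Lemma conjugate_span_stable u : u \in H -> f u \in H.
Proof.
move/coord_span->; rewrite (semilinear_sum fD fZ) rpred_sum // => i _.
by rewrite memvZ // [_`_i]nth_mkseq // -iterS mem_conjugate_span.
Qed.

(** By [orbit_sub], [m] consecutive conjugates in [W] pull in all later ones, and these run
    cyclically through all conjugates. *)
Lemma consecutive_conjugates_span (W : {vspace V}) j m :
    (\dim H <= m)%N -> (forall i, (i < m)%N -> iter (i + j) f r \in W) ->
  (H <= W)%VS.
Proof.
move=> le_Hm Wr; apply: conjugate_span_subv => i _.
have all_W k : iter k f (iter j f r) \in W.
  move: k; apply: (orbit_sub fD fZ (H := H) (m := m)) => // k.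
    by rewrite -iterD mem_conjugate_span.
  by rewrite -iterD; apply: Wr.
(* Starting from index [j], this many further steps lead to [i + j * n], which is [i] modulo [n]. *)
have := all_W (i + j * n.-1)%N; rewrite -iterD -addnA -mulnSr prednK //.
by rewrite iter_modn addnC modnMDl -iter_modn.
Qed.

Lemma conjugate_span_neq0 : r != 0 -> H != 0%VS.
Proof.
apply: contraNneq => H0.
by rewrite -memv0 -H0 (mem_conjugate_span 0).
Qed.

(* As [n] is odd, the indices [0, 2, 3, ..., n - 2] are, modulo [n], the      *)
(* [n - 2] terms [3, 5, ..., n - 2, 0, 2, ..., n - 3] of an arithmetic        *)
(* progression of difference 2, so these are consecutive conjugates under     *)
(* [f \o f].                                                                  *)
Lemma conjugate_span_sub_skip1 (W : {vspace V}) :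
    odd n -> (\dim H <= n - 2)%N -> r \in W ->
    (forall i, (2 <= i <= n - 2)%N -> iter i f r \in W) ->
  (H <= W)%VS.
Proof.
move=> n_odd le_H Wr0 Wr; pose f2 := f \o f.
have f2D : {morph f2 : u v / u + v} by move=> u v; rewrite /f2 /= !fD.
have f2Z a u : f2 (a *: u) = (theta \o theta) a *: f2 u by rewrite /f2 /= !fZ.
have f2E i u : iter i f2 u = iter (i + i) f u.
  by elim: i => //= i ->; rewrite addnS.
have all_W k : iter k f2 (iter 3 f r) \in W.
  move: k; apply: (orbit_sub f2D f2Z (H := H) (m := n - 2)) => // k.
    by rewrite f2E -iterD mem_conjugate_span.
  move=> lt_k; rewrite f2E -iterD.
  have [le_k|gt_k] := leqP (k + k + 3) (n - 2); first by apply: Wr; lia.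
  have [eq_k|ne_k] := eqVneq (k + k + 3)%N n; first by rewrite eq_k fn.
  by rewrite -(@subnK n (k + k + 3)) ?iter_addn; [apply: Wr|]; lia.
apply: conjugate_span_subv => i _.
(* As [n] is odd, this representative of [i] modulo [n] is odd and at least 3. *)
pose j := (if odd i then i + n + n else i + n)%N.
have -> : iter i f r = iter j f r by rewrite /j; case: ifP; rewrite !iter_addn.
have [k ->] : exists k, (j = k + k + 3)%N.
  by exists (j - 3)./2; rewrite /j; case: ifP; lia.
by rewrite iterD -f2E.
Qed.

Variable Gamma : {vspace V}.

Section Collision.

Variable e : n.-tuple V.
Hypotheses (eB : basis_of fullv e) (fe : forall i : 'I_n, f e`_i = e`_i)
  (Gamma0 : forall s, s \in Gamma -> f s = s -> s = 0) (nz_r : r != 0)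
  (rGamma : forall i, (2 <= i <= n - 2)%N -> iter i f r \in Gamma).

(** Otherwise the single conjugate of index 2 would put all of [H] in [Gamma], although [H] contains
    a nonzero fixed vector. *)
Lemma dim_conjugate_span_gt1 : (1 < \dim H)%N.
Proof.
rewrite ltnNge; apply/negP=> le_H1.
have HG : (H <= Gamma)%VS.
  apply: (consecutive_conjugates_span (j := 2) le_H1) => -[|//] _.
  by apply: rGamma; lia.
have [s [Hs nz_s] fs] := invariant_fixed_vector fD fZ eB fe
  conjugate_span_stable (conjugate_span_neq0 nz_r).
by case/eqP: nz_s; apply: Gamma0 (subvP HG s Hs) fs.
Qed.

(** The n - 2 conjugates of indices 1, ..., n - 2 show that [H] lies in [Gamma] plus one line. Two
    independent fixed vectors of [H] are therefore proportional modulo [Gamma]. *)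
Lemma conjugate_span_collision : (\dim H <= n - 2)%N ->
  exists s1 s2, [/\ f s1 = s1, f s2 = s2, s1 != 0, s2 \notin <[s1]>%VS &
    exists c, s2 - c *: s1 \in Gamma].
Proof.
move=> le_H.
have HW : (H <= Gamma + <[iter 1 f r]>)%VS.
  apply: (@consecutive_conjugates_span _ 1 _ le_H) => -[|i] lt_i.
    by apply: (subvP (addvSr _ _)); apply: memv_line.
  by apply: (subvP (addvSl _ _)); apply: rGamma; lia.
have [s1 [s2 [Hs1 Hs2 f1 f2 [nz1 n12]]]] := invariant_two_fixed_vectors fD fZ
  eB fe conjugate_span_stable dim_conjugate_span_gt1.
exists s1, s2; split=> //.
have /memv_addP[w1 Gw1 [_ /vlineP[a1 ->] D1]] := subvP HW _ Hs1.
have /memv_addP[w2 Gw2 [_ /vlineP[a2 ->] D2]] := subvP HW _ Hs2.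
have nz_a1 : a1 != 0.
  apply: contraNneq nz1 => a10; apply/eqP/Gamma0 => //.
  by rewrite D1 a10 scale0r addr0.
exists (a2 / a1); rewrite {1}D1 D2 scalerDr scalerA divfK //.
by rewrite opprD addrACA subrr addr0 rpredB // memvZ.
Qed.

End Collision.

Variable g : {vspace V} -> {vspace V}.
Hypotheses (gE : forall W, [set` g W] = f @` [set` W])
  (dimGamma : \dim Gamma = n.-2)
  (dim_cap2 : (\dim (Gamma :&: g Gamma) <= n - 4)%N).

(** The relation puts the conjugate of index n - 1 in [(Gamma :&: H) + <[iter 1 f r]>]. If [H] were
    a hyperplane, it would thus contain [Gamma], and also [g Gamma]; these would meet in dimension
    at least 2(n - 2) - (n - 1) = n - 3. *)
Lemma conjugate_span_codim1 a b :
    (forall i, (2 <= i <= n - 2)%N -> iter i f r \in Gamma) -> b != 0 ->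
    a *: iter 1 f r + b *: iter n.-1 f r \in Gamma ->
  \dim H != n.-1.
Proof.
move=> rGamma nz_b Gab; apply/eqP=> dimH.
have HW : (H <= (Gamma :&: H) + <[iter 1 f r]>)%VS.
  apply: (@consecutive_conjugates_span _ 1 n.-1); first by rewrite dimH.
  move=> i lt_in; rewrite addn1.
  have r1W : iter 1 f r \in ((Gamma :&: H) + <[iter 1 f r]>)%VS.
    by apply: (subvP (addvSr _ _)); apply: memv_line.
  have [->|i_gt0] := posnP i; first exact: r1W.
  have GHW u : u \in (Gamma :&: H)%VS -> u \in ((Gamma :&: H) + <[iter 1 f r]>)%VS.
    by apply: (subvP (addvSl _ _)).
  have [eq_i|ne_i] := eqVneq i.+1 n.-1; last first.
    by apply: GHW; rewrite memv_cap mem_conjugate_span rGamma //; lia.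
  rewrite eq_i -[iter n.-1 f r](scalerK nz_b) memvZ //.
  rewrite -[_ *: _](addKr (a *: iter 1 f r)) rpredD ?rpredN ?memvZ //.
  apply: GHW; rewrite memv_cap Gab rpredD ?memvZ ?mem_conjugate_span //.
have GH : (Gamma <= H)%VS.
  have := dimvS HW; have := (dimv_add_leqif (Gamma :&: H) <[iter 1 f r]>).1.
  have := dim_vline (iter 1 f r); rewrite dimH => dim1 le1 le2.
  have : (\dim Gamma <= \dim (Gamma :&: H))%N.
    by rewrite dimGamma; move: le1 le2; rewrite dim1; case: (_ != 0) => /=; lia.
  move=> le_dim; have /eqP <- : (Gamma :&: H == Gamma)%VS.
    by rewrite eqEdim capvSl.
  exact: capvSr.
have gGH : (Gamma + g Gamma <= H)%VS.
  rewrite subv_add GH; apply/subvP=> _ /(semilinear_memv gE)[u Gu ->].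
  exact: conjugate_span_stable (subvP GH u Gu).
have := dimv_sum_cap Gamma (g Gamma); have := dimvS gGH.
rewrite (dim_semilinear fD fZ n_gt0 fn gE) dimGamma dimH.
by move: dim_cap2; move: (\dim _) (\dim _) => x y; lia.
Qed.

Variable e : n.-tuple V.
Hypotheses (eB : basis_of fullv e) (fe : forall i : 'I_n, f e`_i = e`_i)
  (Gamma0 : forall s, s \in Gamma -> f s = s -> s = 0).

Let dimV : \dim {:V} = n.
Proof. by rewrite -(size_basis eB). Qed.

Lemma conjugates_in_subspace :
    (n - 5 <= \dim (Gamma :&: g Gamma :&: g (g Gamma)))%N ->
  exists2 r, r != 0 & forall i, (2 <= i <= n - 2)%N -> iter i f r \in Gamma.
Proof.
move=> dim_cap3; pose D := (Gamma :&: g Gamma)%VS.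
have dim_g := dim_semilinear fD fZ n_gt0 fn gE.
have DGamma u : u \in D -> u \in Gamma by rewrite memv_cap => /andP[].
have dimD : \dim D = (n - 5).+1.
  have := dimv_sum_cap Gamma (g Gamma).
  have := dimvS (subvf (Gamma + g Gamma)%VS).
  rewrite dim_g dimGamma dimV; move: dim_cap2; rewrite -/D.
  by move: (\dim D) => d; lia.
have [||r1 nz_r1 Dr1] := semilinear_chain fD fZ n_gt0 fn gE eB fe dimD.
- apply: leq_trans dim_cap3 (dimvS _); apply/subvP=> v.
  rewrite memv_cap => /andP[Dv] /(semilinear_memv gE)[u gu Dvu].
  rewrite memv_cap Dv; move: Dv; rewrite Dvu memv_cap => /andP[_].
  by rewrite !(memv_semilinear n_gt0 fn gE) memv_cap gu andbT.
- by move=> s /DGamma; apply: Gamma0.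
have : r1 \in g Gamma by have := Dr1 0 isT; rewrite memv_cap => /andP[].
case/(semilinear_memv gE)=> r2 Gr2 Dr1'.
(* The n - 3 consecutive conjugates starting at [r2] lie in [Gamma]; this shift gives [r2] the index
   2. *)
exists (iter (n - 2) f r2).
  apply: contraNneq nz_r1 => r0; rewrite Dr1' -[r2]fn -(subnK (_ : 2 <= n)%N).
    by rewrite addnC iterD r0 /= !(semilinear0 fZ).
  exact: leq_trans n_gt4.
case=> [|[|i]] //= le_in; rewrite -!iterS -iterD.
have -> : (i.+2 + (n - 2) = i + n)%N by lia.
rewrite iter_addn; case: i le_in => [|i] le_in //.
rewrite iterSr -Dr1'; apply/DGamma/Dr1; lia.
Qed.

End ConjugatesOfThePoint.

(** * Conjugates in general position *)

Section GenericPoint.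

Variables (F : finFieldType) (L : fieldExtType F) (V : vectType L).
Local Notation n := (\dim {:L}).
Variables (theta : {rmorphism L -> L}) (f : V -> V).
Hypotheses (n_gt4 : (4 < n)%N) (dimV : \dim {:V} = n)
  (fD : {morph f : u v / u + v})
  (fZ : forall a u, f (a *: u) = theta a *: f u)
  (fn : forall u, iter n f u = u)
  (thetan : forall x, iter n theta x = x).
Variables (Sigma : set {vspace V}) (S : {vspace scalar_restr V}).
Hypotheses (SigmaE : Sigma = linear_set S)
  (SE : forall u : V, (u : scalar_restr V) \in S <-> f u = u).
Variables (r : V) (a b : L).
Hypotheses (r_span : conjugate_span n f r = fullv) (nz_a : a != 0).

Local Notation theta' := (iter n.-1 theta).

Let n_gt0 : (0 < n)%N := leq_trans (isT : 0 < 5)%N n_gt4.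
Let n_gt1 : (1 < n)%N := leq_trans (isT : 1 < 5)%N n_gt4.

Let rb : n.-tuple V := map_tuple (fun i => iter i f r) (iota_tuple n 0).

Let rbE (i : 'I_n) : rb`_i = iter i f r.
Proof. by rewrite [LHS]nth_mkseq. Qed.

Let rbB : basis_of fullv rb.
Proof. by rewrite basisEdim size_tuple dimV leqnn andbT -r_span. Qed.

Let i0 : 'I_n := Ordinal n_gt0.
Let i1 : 'I_n := Ordinal n_gt1.
Let lt_z : (n.-1 < n)%N.
Proof. by rewrite prednK. Qed.

Let iz : 'I_n := Ordinal lt_z.

(* Chosen so that [Gamma] is given by the vanishing of the coordinate [0] and  *)
(* of [delta] times the coordinate [1] plus the coordinate [n - 1].           *)
Let delta : L := - (b / a).

Lemma coord_conjugate (j : 'I_n) i :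
  (i < n)%N -> coord rb j (iter i f r) = (i == j)%:R.
Proof.
by move=> lt_in; rewrite -(rbE (Ordinal lt_in)) coord_free ?(basis_free rbB).
Qed.

Lemma memv_conjugate_coords (W : {vspace V}) u :
    (forall j : 'I_n, coord rb j u = 0 \/ iter j f r \in W) -> u \in W.
Proof.
move=> uW; rewrite (coord_basis rbB (memvf u)) rpred_sum // => j _; rewrite rbE.
by case: (uW j) => [->|Wj]; [rewrite scale0r mem0v|rewrite memvZ].
Qed.

(** [f] shifts the conjugates cyclically, so comparing coordinates in [f u = u] makes each
    coordinate the [theta]-image of the preceding one. *)
Lemma coord_fixed u : f u = u ->
  forall j : 'I_n, coord rb j u = iter j theta (coord rb i0 u).
Proof.
move=> fu [m lt_m]; elim: m lt_m => [|m IHm] lt_m /=.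
  by congr (coord rb _ u); apply: val_inj.
rewrite -(IHm (ltnW lt_m)) /= -{1}fu {1}(coord_basis rbB (memvf u)).
rewrite (semilinear_sum fD fZ) linear_sum (bigD1 (Ordinal (ltnW lt_m))) //.
rewrite big1 => [|i ne_im]; rewrite linearZ rbE /= -iterS.
  by rewrite coord_conjugate // eqxx mulr1 addr0.
have [eq_i|ne_i] := eqVneq i.+1 n.
  by rewrite eq_i fn (coord_conjugate _ n_gt0) mulr0.
have lt_i : (i.+1 < n)%N by rewrite ltn_neqAle ne_i ltn_ord.
by rewrite (coord_conjugate _ lt_i) /= eqSS
  (negbTE ne_im : (i == m :> nat) = false) mulr0.
Qed.

Definition fixed_vector (x : L) : V := \sum_(i < n) iter i theta x *: iter i f r.

Lemma fixed_vectorP x : f (fixed_vector x) = fixed_vector x.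
Proof.
rewrite /fixed_vector (semilinear_sum fD fZ) -(prednK n_gt0).
rewrite big_ord_recr [RHS]big_ord_recl /= -!iterS prednK // thetan fn addrC.
by congr (_ + _); apply: eq_bigr.
Qed.

Lemma coord_fixed_vector x (j : 'I_n) :
  coord rb j (fixed_vector x) = iter j theta x.
Proof.
rewrite /fixed_vector; under eq_bigr do rewrite -rbE.
by rewrite coord_sum_free ?(basis_free rbB).
Qed.

Lemma fixed_vector_eq0 x : (fixed_vector x == 0) = (x == 0).
Proof.
apply/eqP/eqP => [x0|->].
  by rewrite -[x](coord_fixed_vector x i0) x0 linear0.
rewrite /fixed_vector big1 // => i _; rewrite (_ : iter i theta 0 = 0) ?scale0r //.
by elim: (i : nat) => //= k ->; rewrite rmorph0.
Qed.

Lemma memv_S_fixed_vector (u : V) : (u : scalar_restr V) \in S ->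
  u = fixed_vector (coord rb i0 u).
Proof.
move=> /SE fu; rewrite {1}(coord_basis rbB (memvf u)); apply: eq_bigr => j _.
by rewrite rbE (coord_fixed fu).
Qed.

(** The transversal is the hyperplane on which the coordinate n - 1 is [delta] times the coordinate
    1; on [fixed_vector x] this reads [theta' x = delta * theta x]. *)
Lemma generic_transversal :
  Sigma `&` points (<[r]> + \sum_(2 <= i < n - 1) <[iter i f r]>
                      + <[(a *: iter 1 f r - b *: iter n.-1 f r)%R]>)%VS = set0 <->
  (forall x, theta' x = delta * theta x -> x = 0).
Proof.
set W := (_ + _)%VS.
have WE u : (u \in W) = (coord rb iz u == delta * coord rb i1 u).
  pose psi : 'Hom(V, L^o) :=
    (linfun (coord rb iz : V -> L^o) - delta *: linfun (coord rb i1 : V -> L^o))%VF.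
  have psiE v : psi v = coord rb iz v - delta * coord rb i1 v.
    by rewrite /psi add_lfunE opp_lfunE scale_lfunE !lfunE.
  have W_ker : (W <= lker psi)%VS.
    have r_ker i : (i < n)%N -> (i != 1)%N -> (i != n.-1)%N ->
        (<[iter i f r]> <= lker psi)%VS.
      move=> lt_i ne1 nez; rewrite -memvE memv_ker psiE !coord_conjugate //=.
      by rewrite (negPf ne1) (negPf nez) mulr0 subrr.
    rewrite !subv_add (r_ker 0%N) //=; last by lia.
    apply/andP; split.
      rewrite big_seq_cond; elim/big_ind: _ => [|U1 U2|i].
      - exact: sub0v.
      - by move=> U1k U2k; rewrite subv_add U1k.
      - by rewrite mem_index_iota andbT => lt_i; apply: r_ker; lia.
    rewrite -memvE memv_ker psiE !linearB !linearZ /= -[f r]/(iter 1 f r).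
    rewrite !coord_conjugate //= !eqxx (_ : (1 == n.-1)%N = false); last by lia.
    rewrite (_ : (n.-1 == 1)%N = false); last by lia.
    by rewrite !mulr0 !mulr1 add0r subr0 /delta mulNr divfK // opprK addNr.
  apply/idP/idP => [/(subvP W_ker)|/eqP u_z].
    by rewrite memv_ker psiE subr_eq0.
  have rW i : (2 <= i <= n - 2)%N -> iter i f r \in W.
    move=> le_i; apply: (subvP (addvSl _ _)); apply: (subvP (addvSr _ _)).
    rewrite (bigD1_seq i) ?iota_uniq ?mem_index_iota //=; last by lia.
    exact: (subvP (addvSl _ _)) (memv_line _).
  (* Subtracting this multiple cancels the coordinate 1 of [u] and, by the equation of the
     hyperplane, the coordinate n - 1 too. *)
  pose w := (coord rb i1 u / a) *: (a *: iter 1 f r - b *: iter n.-1 f r).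
  rewrite -(subrK w u) rpredD //; last first.
    by rewrite memvZ //; apply: (subvP (addvSr _ _)); apply: memv_line.
  apply: memv_conjugate_coords => j.
  have wj : coord rb j w =
      coord rb i1 u / a * (a * (1 == j)%N%:R - b * (n.-1 == j)%N%:R).
    by rewrite linearZ linearB !linearZ /= -[f r]/(iter 1 f r) !coord_conjugate.
  have [lt_j|le_j] := ltnP (n - 2) j.
    left; have jz : j = iz by apply: val_inj; have := ltn_ord j; rewrite /=; lia.
    rewrite linearB /= wj jz /= eqxx (_ : (1 == n.-1)%N = false); last by lia.
    by rewrite u_z mulr0 sub0r mulr1 /delta; field.
  have [lt1j|le1j] := ltnP 1 j; first by right; apply: rW; rewrite lt1j.
  have [j1|ne_j1] := eqVneq (1%N) (j : nat).
    left; have nj : (n.-1 == j)%N = false by lia.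
    rewrite linearB /= wj nj mulr0 subr0 -j1 eqxx.
    have -> : j = i1 by apply: val_inj.
    by rewrite mulr1 divfK // subrr.
  right; have -> : (j : nat) = 0%N by move: le1j ne_j1; lia.
  apply: (subvP (addvSl _ _)); apply: (subvP (addvSl _ _)); exact: memv_line.
split=> [W0 x Dx|no_sol].
  have [//|nz_x] := eqVneq x 0.
  suffices : (Sigma `&` points W) <[fixed_vector x]>%VS by rewrite W0.
  have nz_fx : fixed_vector x != 0 by rewrite fixed_vector_eq0.
  split.
    by rewrite SigmaE; exists (fixed_vector x) => //; split=> //; apply/SE/fixed_vectorP.
  rewrite /points /= dim_vline nz_fx -memvE WE !coord_fixed_vector.
  by split=> //; apply/eqP.
apply/seteqP; split=> // P [+ [_]]; rewrite SigmaE => -[u [Su nz_u] <-].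
rewrite -memvE (memv_S_fixed_vector Su) WE !coord_fixed_vector => /eqP/no_sol u0.
case/eqP: nz_u; rewrite (memv_S_fixed_vector Su) u0; apply/eqP.
by rewrite fixed_vector_eq0.
Qed.

(** * The projection from [Gamma] in the coordinates of the conjugates *)

Variable s : nat.
Hypotheses (n_odd : odd n) (s_lt : (s < n)%N)
  (thetaF : forall h : F, theta h%:A = h%:A)
  (thetaE : forall x, theta x = x ^+ (#|F| ^ s))
  (fixF : forall x, theta x = x -> x \in 1%VS).
Variable Gamma : {vspace V}.
Hypotheses (dimS : \dim S = n) (dimGamma : \dim Gamma = n.-2)
  (Gamma_Sigma : points Gamma `&` Sigma = set0)
  (rGamma : forall i, (2 <= i <= n - 2)%N -> iter i f r \in Gamma)
  (nz_b : b != 0)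
  (Gab : a *: iter 1 f r + b *: iter n.-1 f r \in Gamma).

Lemma fixed_vectorZ (h : F) x : fixed_vector (h *: x) = h%:A *: fixed_vector x.
Proof.
rewrite /fixed_vector scaler_sumr; apply: eq_bigr => i _; rewrite scalerA.
congr (_ *: _); rewrite mulr_algl; elim: (i : nat) => //= m ->.
exact: automorphism_scale.
Qed.

Let theta'E x : theta' x = x ^+ (#|F| ^ (n - s)).
Proof.
rewrite -[RHS](theta'_theta n_gt4 thetan) thetaE -exprM -expnD subnK 1?ltnW //.
by rewrite expf_card_ext.
Qed.

Let LP_vecE x : LP_vec s delta x = (x, delta * theta x + theta' x).
Proof. by rewrite /LP_vec thetaE theta'E. Qed.

(** A model of the projection from [Gamma]: the kernel is [Gamma], and [fixed_vector x] goes to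
    [LP_vec s delta x]. *)
Let phi0 (u : V) : (L^o * L^o)%type :=
  (coord rb i0 u, delta * coord rb i1 u + coord rb iz u).

Let phi0_linear : linear phi0.
Proof.
move=> k u v; rewrite /phi0 !linearP /=; congr (_, _).
by rewrite /GRing.scale /= -[k *: _]/(k * _); ring.
Qed.

Let phi : 'Hom(V, (L^o * L^o)%type) :=
  linfun (HB.pack phi0
      (GRing.isLinear.Build L V (L^o * L^o)%type *:%R phi0 phi0_linear)
    : {linear V -> (L^o * L^o)%type}).

Let phiE u : phi u = (coord rb i0 u, delta * coord rb i1 u + coord rb iz u).
Proof. by rewrite lfunE. Qed.

Let phi_fixed_vector x : phi (fixed_vector x) = LP_vec s delta x.
Proof. by rewrite phiE !coord_fixed_vector LP_vecE. Qed.

Let dimL2 : \dim {:(L^o * L^o)%type} = 2%N.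
Proof. by rewrite dimvf. Qed.

(** A vector of the kernel becomes a combination of the conjugates of indices 2, ..., n - 2 after
    removing a multiple of the given vector of [Gamma]; the dimensions do the rest. *)
Lemma lker_phi : lker phi = Gamma.
Proof.
apply/eqP; rewrite eqEdim; apply/andP; split; last first.
  rewrite dimGamma; have := limg_ker_dim phi fullv; rewrite capfv dimV.
  have := dimvS (subvf (limg phi)); rewrite dimL2.
  by move: (\dim _) (\dim _) => x y; lia.
apply/subvP=> u; rewrite memv_ker phiE => /eqP[u0 u1z].
pose w := (coord rb i1 u / a) *: (a *: iter 1 f r + b *: iter n.-1 f r).
rewrite -(subrK w u) rpredD //; last exact: memvZ.
apply: memv_conjugate_coords => j.
have wj : coord rb j w =
    coord rb i1 u / a * (a * (1 == j)%N%:R + b * (n.-1 == j)%N%:R).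
  by rewrite linearZ linearD !linearZ /= -[f r]/(iter 1 f r) !coord_conjugate.
have [lt_j|le_j] := ltnP (n - 2) j.
  left; have jz : j = iz by apply: val_inj; have := ltn_ord j; rewrite /=; lia.
  rewrite linearB /= wj jz /= eqxx (_ : (1 == n.-1)%N = false); last by lia.
  have -> : coord rb iz u = - (delta * coord rb i1 u).
    by apply/eqP; rewrite -addr_eq0 addrC u1z.
  by rewrite mulr0 add0r mulr1 /delta; field.
have [lt1j|le1j] := ltnP 1 j; first by right; apply: rGamma; rewrite lt1j.
left; have nj : (n.-1 == j)%N = false by lia.
rewrite linearB /= wj nj mulr0 addr0.
have [j1|ne_j1] := eqVneq (1%N) (j : nat).
  have -> : j = i1 by apply: val_inj.
  by rewrite mulr1 divfK // subrr.
have -> : j = i0 by apply: val_inj; move: le1j ne_j1; rewrite /=; lia.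
by rewrite u0 !mulr0 subrr.
Qed.

Lemma generic_max_scattered (Lambda : {vspace V}) :
    \dim Lambda = 2%N -> (Lambda :&: Gamma = 0)%VS ->
  max_scattered Lambda (projection Gamma Lambda Sigma) <->
  (forall x, theta' x = delta * theta x -> x = 0).
Proof.
move=> dimLambda dx.
have dim_sum : (\dim Gamma + \dim Lambda)%N = \dim {:V}.
  by rewrite dimGamma dimLambda dimV; lia.
rewrite (projection_max_scattered dim_sum dx dimS SigmaE Gamma_Sigma).
rewrite -(LP_collisions n_odd n_gt4 thetaF fixF thetan).
split=> [sc y z nz_y eq_yz|sc x y Sx Sy nz_x nz_y k].
  have [->|nz_z] := eqVneq z 0; first by exists 0; rewrite scale0r.
  (* The first coordinate of the images forces this multiplier. *)
  have [|||||k Dk] := sc (fixed_vector y) (fixed_vector z) _ _ _ _ (z / y).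
  - by apply/SE/fixed_vectorP.
  - by apply/SE/fixed_vectorP.
  - by rewrite (_ : (_ : V) != 0) // fixed_vector_eq0.
  - by rewrite (_ : (_ : V) != 0) // fixed_vector_eq0.
  - rewrite -lker_phi memv_ker linearB linearZ /= !phi_fixed_vector !LP_vecE subr_eq0.
    apply/eqP; congr (_, _); first by rewrite /GRing.scale /= divfK.
    rewrite -[_ *: _]/(_ * _); apply: (mulfI nz_y); rewrite -eq_yz.
    by rewrite mulrCA mulrA divfK.
  exists k; rewrite -[LHS](coord_fixed_vector z i0) Dk scalar_restr_scaleE linearZ /=.
  by rewrite coord_fixed_vector mulr_algl.
have [x0 Dx] : exists x0, x = fixed_vector x0.
  by eexists; apply: memv_S_fixed_vector.
have [y0 Dy] : exists y0, y = fixed_vector y0.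
  by eexists; apply: memv_S_fixed_vector.
have -> : ((y : V) - k *: (x : V) \in Gamma) =
    (LP_vec s delta y0 == k *: LP_vec s delta x0).
  rewrite -lker_phi memv_ker linearB linearZ subr_eq0 /=.
  by rewrite Dx Dy !phi_fixed_vector.
rewrite !LP_vecE => /eqP[Dy0 Dy1].
have nz_x0 : x0 != 0 by rewrite -fixed_vector_eq0 -Dx.
have [|h Dh] := sc x0 y0 nz_x0.
  rewrite [in RHS]Dy1 Dy0 -![_ *: _]/(_ * _).
  by ring.
by exists h; rewrite Dy Dx Dh fixed_vectorZ.
Qed.

(** The equivalence is [phi] restricted to [Lambda], with trivial field automorphism: its kernel
    being [Gamma], it is bijective there and does not see the projection. *)
Lemma generic_LP_type (Lambda : {vspace V}) :
    coprime s n -> \dim Lambda = 2%N -> (Lambda :&: Gamma = 0)%VS ->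
    (forall x, theta' x = delta * theta x -> x = 0) ->
  LP_type Lambda (projection Gamma Lambda Sigma).
Proof.
move=> s_coprime dimLambda dx no_sol.
have dim_sum : (\dim Gamma + \dim Lambda)%N = \dim {:V}.
  by rewrite dimGamma dimLambda dimV; lia.
exists s, delta; split=> //.
- by rewrite oppr_eq0 mulf_neq0 ?invr_eq0.
- pose h0 (x : L) : scalar_restr (L^o * L^o)%type := LP_vec s delta x.
  have hB : zmod_morphism h0.
    move=> x y; rewrite /h0 !LP_vecE rmorphB iter_rmorphB; congr (_, _).
    by rewrite /=; ring.
  have hZ : scalable h0.
    move=> h x; rewrite scalar_restr_scaleE /h0 -!phi_fixed_vector fixed_vectorZ.
    by rewrite linearZ.
  pose hBM := GRing.isZmodMorphism.Build _ _ h0 hB.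
  pose hZM := GRing.isScalable.Build _ _ _ _ h0 hZ.
  pose hL : {linear L -> scalar_restr (L^o * L^o)%type} := HB.pack h0 hBM hZM.
  pose G := linfun hL; have GE x : G x = LP_vec s delta x by rewrite lfunE.
  have -> : LP_set s delta = [set <[G x : (L^o * L^o)%type]>%VS |
      x in [set x : L | x \in fullv /\ x != 0]].
    apply/seteqP; split=> [_ [x nz_x <-]|_ [x [_ nz_x] <-]].
      by exists x; [split=> //; apply: memvf|rewrite GE].
    by exists x => //; rewrite GE.
  apply/max_scatteredP => //.
  - apply/eqP; rewrite -subv0; apply/subvP=> x; rewrite memv_cap memv_ker GE memv0.
    by rewrite LP_vecE => /andP[_ /eqP[->]].
  - by apply/subvP=> x _; rewrite mem_vrestr memvf.
  move=> x y _ _ nz_x nz_y eq_xy.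
  have /(LP_collisions n_odd n_gt4 thetaF fixF thetan) sc := no_sol.
  apply: sc => //; have : LP_vec s delta y \in <[LP_vec s delta x]>%VS.
    by rewrite -!GE eq_xy memv_line.
  case/vlineP=> k; rewrite !LP_vecE => -[Dy0 Dy1].
  by rewrite Dy1 {1}Dy0 -![_ *: _]/(_ * _); ring.
have phi_dx : (Lambda :&: lker phi = 0)%VS by rewrite lker_phi.
have phi_proj u : phi (daddv_pi Lambda Gamma u) = phi u.
  apply/esym/eqP; rewrite -subr_eq0 -linearB -memv_ker lker_phi.
  exact: memv_sub_proj.
exists idfun, phi; split.
  split; first by exists idfun.
  - by move=> u v _ _; apply: linearD.
  - by move=> k u _; apply: linearZ.
  split=> [u _|u v|y _]; first exact: memvf.
    rewrite !inE /= => Lu Lv eq_phi; apply/eqP; rewrite -subr_eq0 -memv0 -phi_dx.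
    by rewrite memv_cap rpredB // memv_ker linearB /= eq_phi subrr.
  have : y \in (phi @: Lambda)%VS.
    suffices -> : (phi @: Lambda = fullv)%VS by apply: memvf.
    by apply/eqP; rewrite eqEdim subvf /= limg_dim_eq // dimLambda dimL2.
  by case/memv_imgP=> u Lu ->; exists u.
have img_line u : phi @` [set` <[u]>%VS] = [set` <[phi u]>%VS].
  apply/seteqP; split=> [_ [_ /vlineP[k ->] <-]|v /vlineP[k ->]] /=.
    by rewrite linearZ memvZ // memv_line.
  by exists (k *: u); [rewrite /= memvZ // memv_line|rewrite linearZ].
have proj_point x : x != 0 -> projection Gamma Lambda Sigma
    <[daddv_pi Lambda Gamma (fixed_vector x)]>%VS.
  move=> nz_x; exists <[fixed_vector x]>%VS; last exact: projection_point.
  rewrite SigmaE; exists (fixed_vector x) => //; split.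
    exact/SE/fixed_vectorP.
  by rewrite fixed_vector_eq0.
apply/seteqP; split=> [_ [x nz_x <-]|P [_ [X SX <-]]].
  exists <[daddv_pi Lambda Gamma (fixed_vector x)]>%VS; first exact: proj_point.
  by rewrite img_line phi_proj phi_fixed_vector.
move: SX; rewrite SigmaE => -[u [Su nz_u] <-]; rewrite (projection_point dim_sum dx).
rewrite img_line phi_proj (memv_S_fixed_vector Su) phi_fixed_vector => DP.
exists (coord rb i0 u).
  by rewrite /= -fixed_vector_eq0 -(memv_S_fixed_vector Su).
apply/vspaceP=> v; apply/idP/idP => [Lv|Pv].
  by have : [set` P] v by rewrite DP.
by have : [set` P] v := Pv; rewrite DP.
Qed.

End GenericPoint.

(** * Existence of the point and the harmonic criterion *)

Theorem theorem4p2 (n : nat) (F : finFieldType) (L : fieldExtType F)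
    (V : vectType L) (Sigma : set {vspace V}) (Gamma : {vspace V})
    (sigma : {vspace V} -> {vspace V})
    (n_odd : odd n) (n_ge : (2 <= n - 3)%N)
    (dimL : \dim {:L} = n) (dimV : \dim {:V} = n)
    (Sigma_sub : canonical_subgeometry Sigma)
    (dimGamma : pdim Gamma = n%:Z - 3)
    (Gamma_Sigma : points Gamma `&` Sigma = set0)
    (sigma_gen : generates_stab Sigma sigma)
    (intnGamma : intn sigma Gamma = 2%N) :
  (exists2 R, points fullv R &
     forall i, (2 <= i <= n - 2)%N -> (iter i sigma R <= Gamma)%VS) /\
  (forall R, points fullv R ->
     (forall i, (2 <= i <= n - 2)%N -> (iter i sigma R <= Gamma)%VS) ->
   forall Q Q' Lambda : {vspace V},
     points fullv Q ->
     ((sigma R + iter (n - 1) sigma R) :&: Gamma)%VS = Q ->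
     sigma R <> Q -> Q <> iter (n - 1) sigma R ->
     harmonic (sigma R) (iter (n - 1) sigma R) Q Q' ->
     pdim Lambda = 1 ->
     (Lambda :&: Gamma)%VS = 0%VS ->
     (max_scattered Lambda (projection Gamma Lambda Sigma) /\
      LP_type Lambda (projection Gamma Lambda Sigma)
      <->
      Sigma `&` points (R + (\sum_(2 <= i < n - 1) iter i sigma R) + Q')%VS
      = set0)).
Proof.
subst n; have n_gt4 : (4 < \dim {:L})%N by lia.
have n_gt0 : (0 < \dim {:L})%N by lia.
have [S [e [dimS eB SigmaE SE]]] := canonical_subgeometry_frame dimV Sigma_sub.
pose i0 : 'I_(\dim {:L}) := Ordinal n_gt0.
pose i1 : 'I_(\dim {:L}) := Ordinal (leq_trans (isT : 1 < 5)%N n_gt4).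
have [theta [f [s]]] :=
  @generator_semilinear F L V _ Sigma S e i0 i1 isT eB SE SigmaE sigma erefl
    sigma_gen.
case=> -[fD fZ sE fe] [[thF lt_s s_cop thE fixF] [thn fn]].
have dimG : \dim Gamma = (\dim {:L}).-2.
  by move: dimGamma; rewrite /pdim; lia.
have S_fix (u : V) : (u : scalar_restr V) \in S <-> f u = u.
  have fu i : coord e i (f u) = theta (coord e i u).
    exact: (coord_semilinear fD fZ eB fe).
  split=> [/SE Fu|fix_u]; last by apply/SE => i; apply: fixF; rewrite -fu fix_u.
  rewrite (coord_basis eB (memvf (f u))) [RHS](coord_basis eB (memvf u)).
  by apply: eq_bigr => i _; rewrite fu; have /vlineP[k ->] := Fu i; rewrite thF.
have Gamma0 u : u \in Gamma -> f u = u -> u = 0.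
  move=> Gu fu; apply/eqP; have [//|nz_u] := eqVneq u 0.
  suffices : (points Gamma `&` Sigma) <[u]>%VS by rewrite Gamma_Sigma.
  split; first by rewrite /points /= dim_vline nz_u -memvE.
  by rewrite SigmaE; exists u => //; split=> //; apply/S_fix.
(* The defining inequality of [intn] fails at 1, which bounds the first intersection from above, and
   holds at 2, which bounds the second from below. *)
have [cap2 cap3] : (\dim (Gamma :&: sigma Gamma) <= \dim {:L} - 4)%N /\
    (\dim {:L} - 5 <= \dim (Gamma :&: sigma Gamma :&: sigma (sigma Gamma)))%N.
  have [p2 np1] : intn_pred sigma Gamma 2%N /\ ~~ intn_pred sigma Gamma 1%N.
    move: intnGamma; rewrite /intn; case: ex_minnP => m pm min_m m2.
    by rewrite -m2; split=> //; apply/negP=> p1; have := min_m _ p1; rewrite m2.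
  move: p2 np1; rewrite /intn_pred /pdim !big_ord_recl !big_ord0 /= !capvf capvA.
  by rewrite /bump /= dimG; split; lia.
have line_f := semilinear_iter_vline fZ n_gt0 fn sE.
split.
  have [r nz_r rG] :=
    conjugates_in_subspace fD fZ n_gt4 fn sE dimG cap2 eB fe Gamma0 cap3.
  exists <[r]>%VS; first by split; rewrite ?dim_vline ?nz_r ?subvf.
  by move=> i le_i; rewrite line_f -memvE; apply: rG.
move=> R [dimR _] RG Q Q' Lambda [dimQ _] DQ _ _.
move=> [v0 [v1 [Dv0 Dv1 DQ0 DQ']]] dimLam dx.
have DR : R = <[vpick R]>%VS.
  apply/eqP; rewrite eq_sym eqEdim -memvE memv_pick dimR dim_vline vpick0.
  by rewrite -dimv_eq0 dimR.
move: (vpick R) DR => r DR; subst R.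
have nz_r : r != 0 by move: dimR; rewrite dim_vline; case: (r != 0).
have rG i : (2 <= i <= \dim {:L} - 2)%N -> iter i f r \in Gamma.
  by move=> le_i; have := RG i le_i; rewrite line_f -memvE.
have iter_neq0 i : iter i f r != 0.
  elim: i => //= i; apply: contraNneq => fr0.
  by apply/eqP/(semilinear_inj n_gt0 fn); rewrite fr0 (semilinear0 fZ).
have conj_vec i v : iter i sigma <[r]>%VS = <[v]>%VS ->
    exists2 k, k != 0 & v = k *: iter i f r.
  rewrite line_f => Dv; have : v \in <[iter i f r]>%VS by rewrite Dv memv_line.
  case/vlineP=> k Dk; exists k => //; apply: contraNneq (iter_neq0 i) => k0.
  rewrite -memv0 -(span_seq1 0) span_seq1 -[0](scale0r (iter i f r)) -k0 -Dk.
  by rewrite -Dv memv_line.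
(* The harmonic representatives are multiples of the conjugates of indices 1 and n - 1, so [Q] and
   [Q'] become the lines of their sum and difference with coefficients [a] and [b]. *)
have [a nz_a Da] := conj_vec 1%N v0 Dv0.
have [b nz_b Db] := conj_vec _ v1 Dv1.
rewrite subn1 in Db Dv1.
have Gab : a *: iter 1 f r + b *: iter (\dim {:L}).-1 f r \in Gamma.
  by rewrite -Da -Db memvE -DQ0 -DQ capvSr.
have dimLambda : \dim Lambda = 2%N by move: dimLam; rewrite /pdim; lia.
rewrite (eq_bigr _ (fun i _ => line_f i r)) DQ' Da Db.
set H := conjugate_span (\dim {:L}) f r.
have [dimH|lt_H] := eqVneq (\dim H) (\dim {:L}).
  have H_full : H = fullv by apply/eqP; rewrite eqEdim subvf dimH dimV /=.
  have tv := generic_transversal n_gt4 dimV fD fZ fn thn SigmaE S_fix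
    b H_full nz_a.
  have ms := generic_max_scattered n_gt4 dimV fD fZ fn thn SigmaE S_fix H_full
    nz_a n_odd lt_s thF thE fixF dimS dimG Gamma_Sigma rG nz_b Gab dimLambda dx.
  have lp := generic_LP_type n_gt4 dimV fD fZ fn thn SigmaE S_fix H_full
    nz_a n_odd lt_s thF thE fixF dimS dimG rG nz_b Gab s_cop dimLambda dx.
  rewrite tv -ms; split=> [[]//|sc]; split=> //; apply: lp; exact/ms.
have {lt_H} le_H : (\dim H <= \dim {:L} - 2)%N.
  have := conjugate_span_codim1 fD fZ n_gt4 fn sE dimG cap2 rG nz_b Gab.
  have := dimvS (subvf H); rewrite dimV -/H; move: lt_H; lia.
have [s1 [s2 [fs1 fs2 nz_s1 s12 [k Gk]]]] :=
  conjugate_span_collision fD fZ n_gt4 fn eB fe Gamma0 nz_r rG le_H.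
have nz_s2 : s2 != 0 by apply: contraNneq s12 => ->; apply: mem0v.
(* In this degenerate case both sides of the equivalence are false, and each direction ends in a
   contradiction. *)
split=> [[ms _]|W0].
  have dim_sum : (\dim Gamma + \dim Lambda)%N = \dim {:V}.
    by rewrite dimG dimLambda dimV; lia.
  have dimSL : \dim S = \dim {:L} by [].
  have sc := (projection_max_scattered dim_sum dx dimSL SigmaE Gamma_Sigma).1 ms.
  have [||||h Dh] := sc s1 s2 _ _ _ _ k Gk; [exact/S_fix|exact/S_fix|by []|by []|].
  by case/negP: s12; rewrite Dh scalar_restr_scaleE memvZ // memv_line.
set W := (_ + _)%VS in W0.
have HW : (H <= W)%VS.
  apply: (conjugate_span_sub_skip1 fD fZ n_gt4 fn n_odd le_H).
    by apply: (subvP (addvSl _ _)); apply: (subvP (addvSl _ _)); apply: memv_line.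
  move=> i le_i; apply: (subvP (addvSl _ _)); apply: (subvP (addvSr _ _)).
  rewrite (bigD1_seq i) ?iota_uniq ?mem_index_iota //=; last by lia.
  exact: (subvP (addvSl _ _)) (memv_line _).
have [t [Ht nz_t] ft] := invariant_fixed_vector fD fZ eB fe
  (conjugate_span_stable fD fZ n_gt4 fn (r := r))
  (conjugate_span_neq0 n_gt4 fn nz_r).
suffices : (Sigma `&` points W) <[t]>%VS by rewrite W0.
split; first by rewrite SigmaE; exists t => //; split=> //; apply/S_fix.
by rewrite /points /= dim_vline nz_t -memvE; split=> //; apply: (subvP HW).
Qed.
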